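(* Let $\mathcal{C}$ be a premodular category with simple objects $X_0=\mathbb{I},X_1,\ldots,X_{n-1}$ (up to isomorphism), and let $X_a$ be a simple self-dual object of $\mathcal{C}$. Then the second Frobenius–Schur indicator of $X_a$ is $$\nu_2(X_a)=\frac{1}{D^{2}}\sum_{b,c}N_{bc}^{a}\,d_b d_c\left(\frac{\theta_b}{\theta_c}\right)^{2}-\theta_a\sum_{\gamma\in\mathcal{C}'\setminus\{\mathbb{I}\}}d_\gamma\,\mathrm{Tr}\left(R_\gamma^{aa}\right),$$ where $b,c$ run over all labels of simple objects of $\mathcal{C}$, and $\gamma$ runs over the labels of the simple objects, other than the unit, lying in the Müger center $\mathcal{C}'$.
   Context: A premodular category is a $\mathbb{C}$-linear braided, balanced, spherical fusion category (i.e. a ribbon fusion category over $\mathbb{C}$), assumed strict without loss of generality. The simple objects up to isomorphism are $X_0=\mathbb{I},X_1,\ldots,X_{n-1}$; $N_{bc}^{a}=\dim\mathrm{Hom}(X_b\otimes X_c,X_a)$; $d_a=\dim X_a$ is the categorical (spherical trace) dimension; $D^2=\sum_b d_b^2$; $\theta_a\in\mathbb{C}^\times$ is the scalar by which the twist acts on $X_a$, with the convention $\theta_{X\otimes Y}=c_{Y,X}c_{X,Y}(\theta_X\otimes\theta_Y)$ for the braiding $c$. The Müger center $\mathcal{C}'$ is the full subcategory of objects $X$ with $c_{Y,X}c_{X,Y}=\mathrm{id}_{X\otimes Y}$ for all $Y\in\mathcal{C}$. $R_\gamma^{aa}$ is the linear operator on the splitting space $V_\gamma^{aa}=\mathrm{Hom}(X_\gamma,X_a\otimes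 X_a)$ given by $f\mapsto c_{X_a,X_a}\circ f$, and $\mathrm{Tr}(R_\gamma^{aa})$ is its trace as a linear operator (zero if $V_\gamma^{aa}=0$). The second Frobenius–Schur indicator (Ng–Schauenburg) of an object $V$ is $\nu_2(V)=\mathrm{Tr}(E_V^{(2)})$, where $E_V^{(2)}:\mathrm{Hom}(\mathbb{I},V\otimes V)\to\mathrm{Hom}(\mathbb{I},V\otimes V)$ is the linear map that rotates the first tensor factor $V$ around to the last position using the evaluation, coevaluation and pivotal structure. For $X_a$ simple and self-dual this equals $\theta_a$ times the scalar by which $R_0^{aa}$ acts on the one-dimensional space $\mathrm{Hom}(\mathbb{I},X_a\otimes X_a)$. *)

(* Defs.v *)
From mathcomp Require Import all_boot all_order all_algebra.
From mathcomp Require Import reals complex.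

Set Implicit Arguments.
Unset Strict Implicit.
Unset Printing Implicit Defensive.

Import GRing.Theory.
Local Open Scope ring_scope.
Local Open Scope complex_scope.

(* The field of complex numbers is R[i], for a model R of the real numbers;
   vectType makes the Hom spaces finite-dimensional. *)
Record linearCategory (R : realType) := LinearCategory {
  obj :> Type;
  hom : obj -> obj -> vectType R[i];
  idm : forall X, hom X X;
  comp : forall X Y Z, hom Y Z -> hom X Y -> hom X Z;
  comp1m : forall X Y (f : hom X Y), comp (idm Y) f = f;
  compm1 : forall X Y (f : hom X Y), comp f (idm X) = f;
  compA : forall W X Y Z (h : hom Y Z) (g : hom X Y) (f : hom W X),
    comp h (comp g f) = comp (comp h g) f;
  comp_linearl : forall X Y Z (a : R[i]) (g g' : hom Y Z) (f : hom X Y),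
    comp (a *: g + g') f = a *: comp g f + comp g' f;
  comp_linearr : forall X Y Z (a : R[i]) (g : hom Y Z) (f f' : hom X Y),
    comp g (a *: f + f') = a *: comp g f + comp g f'
}.

Arguments hom {R l} X Y.
Arguments idm {R l} X.
Arguments comp {R l X Y Z} g f.

Notation "g ∘ f" := (comp g f) (at level 40, left associativity).

Section LinearCategory.
Variables (R : realType) (C : linearCategory R).
Implicit Types X Y Z : C.

Definition eqm X Y (e : X = Y) : hom X Y :=
  match e in _ = Z return hom X Z with erefl => idm X end.

Definition is_iso X Y (f : hom X Y) : Prop :=
  exists g : hom Y X, g ∘ f = idm X /\ f ∘ g = idm Y.

Definition isomorphic X Y : Prop := exists f : hom X Y, is_iso f.

Definition is_mono X Y (f : hom X Y) : Prop :=
  forall Z (g h : hom Z X), f ∘ g = f ∘ h -> g = h.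

Definition is_epi X Y (f : hom X Y) : Prop :=
  forall Z (g h : hom Y Z), g ∘ f = h ∘ f -> g = h.

Definition is_kernel X Y K (f : hom X Y) (k : hom K X) : Prop :=
  f ∘ k = 0 /\
  forall Z (g : hom Z X), f ∘ g = 0 -> exists! h : hom Z K, k ∘ h = g.

Definition is_cokernel X Y Q (f : hom X Y) (q : hom Y Q) : Prop :=
  q ∘ f = 0 /\
  forall Z (g : hom Y Z), g ∘ f = 0 -> exists! h : hom Q Z, h ∘ q = g.

Definition is_direct_sum n (F : 'I_n -> C) X : Prop :=
  exists (inj : forall k, hom (F k) X) (proj : forall k, hom X (F k)),
    [/\ forall k, proj k ∘ inj k = idm (F k),
        forall k l, k != l -> proj k ∘ inj l = 0
      & \sum_(k < n) inj k ∘ proj k = idm X].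

(* The empty direct sum is a zero object. *)
Definition is_abelian : Prop :=
  (forall n (F : 'I_n -> C), exists X, is_direct_sum F X) /\
  [/\ forall X Y (f : hom X Y), exists K (k : hom K X), is_kernel f k,
      forall X Y (f : hom X Y), exists Q (q : hom Y Q), is_cokernel f q,
      forall X Y (f : hom X Y), is_mono f ->
        exists Z (g : hom Y Z), is_kernel g f
    & forall X Y (f : hom X Y), is_epi f ->
        exists Z (g : hom Z X), is_cokernel g f].

(* A mono is 0 exactly when its source is a zero object. *)
Definition is_simple X : Prop :=
  idm X <> 0 /\
  forall Y (m : hom Y X), is_mono m -> m = 0 \/ is_iso m.

Definition is_semisimple : Prop :=
  forall X, exists n (F : 'I_n -> C),
    (forall k, is_simple (F k)) /\ is_direct_sum F X.

Definition represents_simples n (S : 'I_n -> C) : Prop :=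
  [/\ forall k, is_simple (S k),
      forall k l, isomorphic (S k) (S l) -> k = l
    & forall X, is_simple X -> exists k, isomorphic X (S k)].

(* The scalar z when f = z *: idm X and X is nonzero. *)
Definition scalar_of X (f : hom X X) : R[i] :=
  coord [tuple idm X] ord0 f.

End LinearCategory.

Definition op_trace (K : fieldType) (V : vectType K) (f : V -> V) : K :=
  \sum_(i < \dim {:V}) coord (vbasis {:V}) i (f (vbasis {:V})`_i).

(* The associativity and unit constraints are the identities [eqm _]; hence
   no pentagon or triangle axiom is needed. *)
Record monoidalCategory (R : realType) := MonoidalCategory {
  mon_cat :> linearCategory R;
  unit_ob : mon_cat;
  tens : mon_cat -> mon_cat -> mon_cat;
  tensA : forall X Y Z, tens X (tens Y Z) = tens (tens X Y) Z;
  tens1 : forall X, tens unit_ob X = X;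
  tens_1 : forall X, tens X unit_ob = X;
  tensm : forall X X' Y Y' : mon_cat,
    hom X X' -> hom Y Y' -> hom (tens X Y) (tens X' Y');
  tensm_id : forall X Y, tensm (idm X) (idm Y) = idm (tens X Y);
  tensm_comp : forall X X' X'' Y Y' Y'' (f' : hom X' X'') (f : hom X X')
    (g' : hom Y' Y'') (g : hom Y Y'),
    tensm (f' ∘ f) (g' ∘ g) = tensm f' g' ∘ tensm f g;
  tensm_linearl : forall X X' Y Y' (a : R[i]) (f f' : hom X X') (g : hom Y Y'),
    tensm (a *: f + f') g = a *: tensm f g + tensm f' g;
  tensm_linearr : forall X X' Y Y' (a : R[i]) (f : hom X X') (g g' : hom Y Y'),
    tensm f (a *: g + g') = a *: tensm f g + tensm f g';
  tensmA : forall X X' Y Y' Z Z' (f : hom X X') (g : hom Y Y') (h : hom Z Z'),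
    eqm (tensA X' Y' Z') ∘ tensm f (tensm g h) =
    tensm (tensm f g) h ∘ eqm (tensA X Y Z);
  tens1m : forall X X' (f : hom X X'),
    eqm (tens1 X') ∘ tensm (idm unit_ob) f = f ∘ eqm (tens1 X);
  tensm1 : forall X X' (f : hom X X'),
    eqm (tens_1 X') ∘ tensm f (idm unit_ob) = f ∘ eqm (tens_1 X)
}.

Arguments unit_ob {R m}.
Arguments tens {R m} X Y.
Arguments tensm {R m X X' Y Y'} f g.

Notation "𝟙" := unit_ob.
Notation "X ⊗ Y" := (tens X Y) (at level 35, right associativity).
Notation "f ⊠ g" := (tensm f g) (at level 35, right associativity).

Section Constraints.
Variables (R : realType) (C : monoidalCategory R).
Implicit Types X Y Z : C.

Definition assoc X Y Z : hom (X ⊗ (Y ⊗ Z)) ((X ⊗ Y) ⊗ Z) :=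
  eqm (tensA X Y Z).
Definition assocV X Y Z : hom ((X ⊗ Y) ⊗ Z) (X ⊗ (Y ⊗ Z)) :=
  eqm (esym (tensA X Y Z)).
Definition lunit X : hom (𝟙 ⊗ X) X := eqm (tens1 X).
Definition lunitV X : hom X (𝟙 ⊗ X) := eqm (esym (tens1 X)).
Definition runit X : hom (X ⊗ 𝟙) X := eqm (tens_1 X).
Definition runitV X : hom X (X ⊗ 𝟙) := eqm (esym (tens_1 X)).

End Constraints.

Record ribbonCategory (R : realType) := RibbonCategory {
  rib_mon :> monoidalCategory R;
  braid : forall X Y : rib_mon, hom (X ⊗ Y) (Y ⊗ X);
  braid_iso : forall X Y, is_iso (braid X Y);
  braid_nat : forall (X X' Y Y' : rib_mon) (f : hom X X') (g : hom Y Y'),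
    braid X' Y' ∘ (f ⊠ g) = (g ⊠ f) ∘ braid X Y;
  braid_tensr : forall X Y Z,
    braid X (Y ⊗ Z) =
    assoc Y Z X ∘ (idm Y ⊠ braid X Z) ∘ assocV Y X Z
      ∘ (braid X Y ⊠ idm Z) ∘ assoc X Y Z;
  braid_tensl : forall X Y Z,
    braid (X ⊗ Y) Z =
    assocV Z X Y ∘ (braid X Z ⊠ idm Y) ∘ assoc X Z Y
      ∘ (idm X ⊠ braid Y Z) ∘ assocV X Y Z;
  twist : forall X : rib_mon, hom X X;
  twist_iso : forall X, is_iso (twist X);
  twist_nat : forall (X Y : rib_mon) (f : hom X Y), twist Y ∘ f = f ∘ twist X;
  twist_tens : forall X Y,
    twist (X ⊗ Y) = braid Y X ∘ braid X Y ∘ (twist X ⊠ twist Y);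
  dual : rib_mon -> rib_mon;
  ev : forall X, hom (dual X ⊗ X) 𝟙;
  coev : forall X, hom 𝟙 (X ⊗ dual X);
  zigzag : forall X,
    runit X ∘ (idm X ⊠ ev X) ∘ assocV X (dual X) X
      ∘ (coev X ⊠ idm X) ∘ lunitV X = idm X;
  zigzag_dual : forall X,
    lunit (dual X) ∘ (ev X ⊠ idm (dual X)) ∘ assoc (dual X) X (dual X)
      ∘ (idm (dual X) ⊠ coev X) ∘ runitV (dual X) = idm (dual X);
  (* says that twist (dual X) is the transpose of twist X *)
  twist_dual : forall X,
    (twist X ⊠ idm (dual X)) ∘ coev X = (idm X ⊠ twist (dual X)) ∘ coev X
}.

Arguments braid {R r} X Y.
Arguments twist {R r} X.
Arguments dual {R r} X.
Arguments ev {R r} X.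
Arguments coev {R r} X.

Section Ribbon.
Variables (R : realType) (C : ribbonCategory R).
Implicit Types X Y : C.

(* The twist determines the spherical structure of a ribbon category: dual X
   is also a right dual of X through the following two morphisms. They are
   ev (dual X) ∘ (j X ⊠ id) and (id ⊠ (j X)^-1) ∘ coev (dual X), where
   j X : X -> dual (dual X) is the pivotal structure, that is, the Drinfeld
   morphism of X composed with twist X. *)
Definition ev' X : hom (X ⊗ dual X) 𝟙 :=
  ev X ∘ braid X (dual X) ∘ (twist X ⊠ idm (dual X)).
Definition coev' X : hom 𝟙 (dual X ⊗ X) :=
  (idm (dual X) ⊠ twist X) ∘ braid X (dual X) ∘ coev X.

Definition spherical_trace X (f : hom X X) : R[i] :=
  scalar_of (ev' X ∘ (f ⊠ idm (dual X)) ∘ coev X).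

Definition qdim X : R[i] := spherical_trace (idm X).

Definition twist_scalar X : R[i] := scalar_of (twist X).

Definition is_transparent X : Prop :=
  forall Y, braid Y X ∘ braid X Y = idm (X ⊗ Y).

Definition self_dual X : Prop := isomorphic X (dual X).

Definition fusion_coef X Y Z : nat := \dim {: hom (X ⊗ Y) Z}.

Definition R_op Z X (f : hom Z (X ⊗ X)) : hom Z (X ⊗ X) := braid X X ∘ f.

(* With f written as v1 ⊗ v2: a cup dual X ⊗ X is created around f, and its
   left leg is contracted with v1, which leaves v2 ⊗ v1. *)
Definition FS_rotation X (f : hom 𝟙 (X ⊗ X)) : hom 𝟙 (X ⊗ X) :=
  lunit (X ⊗ X) ∘ (ev X ⊠ idm (X ⊗ X)) ∘ assoc (dual X) X (X ⊗ X)
    ∘ (idm (dual X) ⊠ (assocV X X X ∘ (f ⊠ idm X) ∘ lunitV X)) ∘ coev' X.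

Definition FS_indicator2 X : R[i] := op_trace (@FS_rotation X).

End Ribbon.

Record premodularCategory (R : realType) := PremodularCategory {
  pm_ribbon :> ribbonCategory R;
  pm_abelian : is_abelian pm_ribbon;
  pm_semisimple : is_semisimple pm_ribbon;
  pm_finite : exists n (S : 'I_n -> pm_ribbon), represents_simples S;
  pm_unit_simple : is_simple (𝟙 : pm_ribbon)
}.

(* Main.v *)
From HB Require Import structures.
From mathcomp Require Import all_boot all_order all_algebra.
From mathcomp Require Import boolp reals complex ring.
Require Import Defs.

(* Let M_{X,Y} be the monodromy of X and Y, and s(g,b) the trace of M_{X_g,X_b}.
   On strands a, a, b, Yang-Baxter moves turn M_{aa,b} (c_{a,a} ⊗ b) into
   (a ⊗ M_{a,b}) (c_{a,a} ⊗ b) (a ⊗ M_{a,b}); closing the first strand leaves a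
   kink, so the trace is theta_a tr(M_{a,b}^2), which the balancing axiom
   evaluates. Decomposing a ⊗ a instead gives sum_g Tr(R_g^{aa}) s(g,b).
   Multiply by d_b and sum over b. By the handle slide, sum_b d_b s(g,b) vanishes
   unless g is transparent, in which case it is d_g D^2; and D^2 is not 0,
   because the d_b are real (d is a common eigenvector of the fusion matrices).
   The term of the unit is nu_2, since the rotation is theta_a R_0^{aa}.

   Associativity being an equality of objects, diagrams are drawn on
   right-nested words X ⊗ (Y ⊗ (... ⊗ Z)): every elementary morphism acts on the
   leading strands and is natural in the remaining object Z, so that no
   associativity constraint appears. *)

Set Implicit Arguments.
Unset Strict Implicit.
Unset Printing Implicit Defensive.

Import GRing.Theory Num.Theory.
Local Open Scope ring_scope.
Local Open Scope complex_scope.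

Notation "X ◁ f" := (idm X ⊠ f) (at level 35, right associativity).
Notation "f ▷ Z" := (f ⊠ idm Z) (at level 32, left associativity).

(** * Composites, and coherence of constraints that are equalities *)

Section Chains.
Variables (R : realType) (C : linearCategory R).
Implicit Types A B X Y Z W : C.

Lemma eqm_id X (e : X = X) : eqm e = idm X.
Proof. by rewrite (Prop_irrelevance e erefl). Qed.

(** Proof irrelevance of equalities between objects takes the place of a coherence theorem: parallel
    composites of constraints always agree. *)
Lemma eqm_irr X Y (e e' : X = Y) : eqm e = eqm e'.
Proof. by rewrite (Prop_irrelevance e e'). Qed.

Lemma eqmM X Y Z (e : X = Y) (e' : Y = Z) :
  eqm e' ∘ eqm e = eqm (etrans e e').
Proof. by case: _ / e'; rewrite comp1m; exact: eqm_irr. Qed.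

Lemma eqmMk X Y Z W (k : hom Z W) (e : X = Y) (e' : Y = Z) :
  k ∘ eqm e' ∘ eqm e = k ∘ eqm (etrans e e').
Proof. by rewrite -compA eqmM. Qed.

Lemma comp_cong X Y Z (g g' : hom Y Z) (f f' : hom X Y) :
  g = g' -> f = f' -> g ∘ f = g' ∘ f'.
Proof. by move=> -> ->. Qed.

(** Composites are kept left-nested, so two adjacent factors are not a subterm unless they come
    first. This form, and [comp_eq3] for three factors, rewrites them behind an arbitrary prefix
    [k]. *)
Lemma comp_eq2 X Y Z (a : hom Y Z) (b : hom X Y) p :
  a ∘ b = p -> forall W (k : hom Z W), k ∘ a ∘ b = k ∘ p.
Proof. by move=> E W k; rewrite -compA E. Qed.

Lemma comp_eq3 X Y Z A (a : hom Y Z) (b : hom X Y) (c : hom A X) p :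
  a ∘ b ∘ c = p -> forall W (k : hom Z W), k ∘ a ∘ b ∘ c = k ∘ p.
Proof. by move=> E W k; rewrite -E !compA. Qed.

End Chains.

Section Coherence.
Variables (R : realType) (C : ribbonCategory R).
Implicit Types A B X Y Z W : C.

Lemma tens_eqmr X Y Z (e : Y = Z) : X ◁ eqm e = eqm (f_equal (tens X) e).
Proof. by case: _ / e; rewrite /= tensm_id. Qed.

Lemma tens_eqml X Y Z (e : Y = Z) :
  eqm e ▷ X = eqm (f_equal (fun Y => tens Y X) e).
Proof. by case: _ / e; rewrite /= tensm_id. Qed.

Lemma ltensM X A B D (g : hom B D) (f : hom A B) :
  X ◁ (g ∘ f) = X ◁ g ∘ X ◁ f.
Proof. by rewrite -tensm_comp comp1m. Qed.

Lemma rtensM X A B D (g : hom B D) (f : hom A B) :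
  (g ∘ f) ▷ X = g ▷ X ∘ f ▷ X.
Proof. by rewrite -tensm_comp comp1m. Qed.

Lemma interchange A B A' B' (f : hom A B) (g : hom A' B') :
  f ▷ B' ∘ A ◁ g = B ◁ g ∘ f ▷ A'.
Proof. by rewrite -!tensm_comp !comp1m !compm1. Qed.

Lemma ltens_eq2 V X Y Z (a : hom Y Z) (b : hom X Y) p :
  a ∘ b = p -> V ◁ a ∘ V ◁ b = V ◁ p.
Proof. by move=> <-; rewrite ltensM. Qed.

Lemma ltens_eq3 V A X Y Z (a : hom Y Z) (b : hom X Y) (c : hom A X) p :
  a ∘ b ∘ c = p -> V ◁ a ∘ V ◁ b ∘ V ◁ c = V ◁ p.
Proof. by move=> <-; rewrite !ltensM. Qed.

Lemma assocK X Y Z : assocV X Y Z ∘ assoc X Y Z = idm _.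
Proof. by rewrite eqmM eqm_id. Qed.

Lemma assocVK X Y Z : assoc X Y Z ∘ assocV X Y Z = idm _.
Proof. by rewrite eqmM eqm_id. Qed.

Lemma lunitK X : lunitV X ∘ lunit X = idm _.
Proof. by rewrite eqmM eqm_id. Qed.

Lemma lunitVK X : lunit X ∘ lunitV X = idm _.
Proof. by rewrite eqmM eqm_id. Qed.

Lemma runitK X : runitV X ∘ runit X = idm _.
Proof. by rewrite eqmM eqm_id. Qed.

Lemma runitVK X : runit X ∘ runitV X = idm _.
Proof. by rewrite eqmM eqm_id. Qed.

Lemma assocV_nat X X' Y Y' Z Z' (f : hom X X') (g : hom Y Y') (h : hom Z Z') :
  assocV X' Y' Z' ∘ ((f ⊠ g) ⊠ h) = (f ⊠ (g ⊠ h)) ∘ assocV X Y Z.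
Proof.
rewrite -[LHS]compm1 -(assocVK X Y Z) compA -(compA (assocV _ _ _)).
by rewrite -tensmA !compA assocK comp1m.
Qed.

Lemma lunitV_nat X Y (f : hom X Y) : lunitV Y ∘ f = 𝟙 ◁ f ∘ lunitV X.
Proof.
rewrite -[LHS]compm1 -(lunitVK X) compA -(compA (lunitV _)) -tens1m.
by rewrite !compA lunitK comp1m.
Qed.

Lemma runitV_nat X Y (f : hom X Y) : runitV Y ∘ f = f ▷ 𝟙 ∘ runitV X.
Proof.
rewrite -[LHS]compm1 -(runitVK X) compA -(compA (runitV _)) -tensm1.
by rewrite !compA runitK comp1m.
Qed.

Lemma lrtens X Z A B (f : hom A B) :
  (X ◁ f) ▷ Z = assoc X B Z ∘ X ◁ (f ▷ Z) ∘ assocV X A Z.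
Proof. by rewrite tensmA -compA assocVK compm1. Qed.

Lemma rrtens Y Z A B (f : hom A B) :
  f ▷ Y ▷ Z = assoc B Y Z ∘ f ▷ (Y ⊗ Z) ∘ assocV A Y Z.
Proof. by rewrite -tensm_id tensmA -compA assocVK compm1. Qed.

Lemma lltens X Y A B (f : hom A B) :
  X ◁ (Y ◁ f) = assocV X Y B ∘ (X ⊗ Y) ◁ f ∘ assoc X Y A.
Proof. by rewrite -tensm_id assocV_nat -compA assocK compm1. Qed.

End Coherence.

(** Whiskered constraints become constraints and adjacent ones fuse. What remains is the list of
    proper morphisms separated by single [eqm], which [eqm_cong] compares factor by factor. *)
Ltac eqm_chain :=
  rewrite /assoc /assocV /lunit /lunitV /runit /runitV ?tens_eqmr ?tens_eqml;
  rewrite ?compA ?(eqmM, eqmMk).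

Ltac eqm_cong := do ?[exact: eqm_irr | exact: erefl | apply: comp_cong].

(** * Crossings, caps and cups *)

Section Calculus.
Variables (R : realType) (C : ribbonCategory R).
Implicit Types A B X Y Z W : C.

(* Locked, because otherwise the associativity of composition unifies with the
   bodies of these definitions. *)
Fact word_key : unit. Proof. by []. Qed.

Definition br X Y Z : hom (X ⊗ (Y ⊗ Z)) (Y ⊗ (X ⊗ Z)) :=
  locked_with word_key (assocV Y X Z ∘ braid X Y ▷ Z ∘ assoc X Y Z).

Lemma brE X Y Z :
  br X Y Z = assocV Y X Z ∘ braid X Y ▷ Z ∘ assoc X Y Z.
Proof. by rewrite /br locked_withE. Qed.

Lemma br_natr X Y A B (h : hom A B) :
  br X Y B ∘ X ◁ (Y ◁ h) = Y ◁ (X ◁ h) ∘ br X Y A.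
Proof.
rewrite !brE (lltens X) (lltens Y) !compA -!(compA _ _ (assocV Y X A)).
rewrite assocVK compm1 -!(compA _ (assoc _ _ _) (assocV _ _ _)) assocVK compm1.
by congr (_ ∘ _); rewrite -!compA interchange.
Qed.

Lemma br_nat1 X X' Y Z (f : hom X X') :
  br X' Y Z ∘ f ▷ (Y ⊗ Z) = Y ◁ (f ▷ Z) ∘ br X Y Z.
Proof.
rewrite !brE -tensm_id -compA tensmA !compA; congr (_ ∘ _).
rewrite -assocV_nat -!compA; congr (_ ∘ _).
by rewrite -!rtensM braid_nat.
Qed.

Lemma br_nat2 X Y Y' Z (f : hom Y Y') :
  br X Y' Z ∘ X ◁ (f ▷ Z) = f ▷ (X ⊗ Z) ∘ br X Y Z.
Proof.
rewrite !brE -tensm_id -compA tensmA !compA; congr (_ ∘ _).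
rewrite -assocV_nat -!compA; congr (_ ∘ _).
by rewrite -!rtensM braid_nat.
Qed.

Lemma br_hexr W X Y Z :
  assocV X Y (W ⊗ Z) ∘ br W (X ⊗ Y) Z =
  X ◁ br W Y Z ∘ br W X (Y ⊗ Z) ∘ W ◁ assocV X Y Z.
Proof.
rewrite !brE braid_tensr !rtensM !ltensM lrtens rrtens.
eqm_chain.
eqm_cong.
Qed.

Lemma br_hexl X Y W Z :
  W ◁ assocV X Y Z ∘ br (X ⊗ Y) W Z =
  br X W (Y ⊗ Z) ∘ X ◁ br Y W Z ∘ assocV X Y (W ⊗ Z).
Proof.
rewrite !brE braid_tensl !rtensM !ltensM lrtens rrtens.
eqm_chain.
eqm_cong.
Qed.

Lemma iso_cancell X Y Z (f : hom Y Z) (g h : hom X Y) :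
  is_iso f -> f ∘ g = f ∘ h -> g = h.
Proof.
move=> [f' [fK _]] E.
by rewrite -(comp1m g) -(comp1m h) -fK -!compA E.
Qed.

Lemma iso_cancelr X Y Z (f : hom X Y) (g h : hom Y Z) :
  is_iso f -> g ∘ f = h ∘ f -> g = h.
Proof.
move=> [f' [_ fK]] E.
by rewrite -(compm1 g) -(compm1 h) -fK !compA E.
Qed.

Lemma eqm_iso X Y (e : X = Y) : is_iso (eqm e).
Proof. by case: _ / e; exists (idm X); rewrite comp1m. Qed.

(** Naturality along [𝟙 ⊗ 𝟙 = 𝟙] and the hexagon express the braiding, up to constraints, as the
    product of two copies of itself. Cancelling one copy shows that the other is a constraint. *)
Lemma braid_unitr W : braid W 𝟙 = lunitV W ∘ runit W.
Proof.
have := @braid_nat R C W W _ _ (idm W) (lunit 𝟙).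
rewrite braid_tensr.
have -> : idm 𝟙 ⊠ braid W 𝟙 = lunitV _ ∘ braid W 𝟙 ∘ lunit _.
  by rewrite -compA -tens1m compA lunitK comp1m.
have -> : braid W 𝟙 ⊠ idm 𝟙 = runitV _ ∘ braid W 𝟙 ∘ runit _.
  by rewrite -compA -tensm1 compA runitK comp1m.
eqm_chain; rewrite eqm_id comp1m -!compA => /(iso_cancell (braid_iso W 𝟙)).
set e2 := eqm _; set e1 := eqm _; set e0 := eqm _ => E.
have {}E : e1 ∘ braid W 𝟙 = idm _.
  apply: (iso_cancelr (eqm_iso (etrans (tensA W 𝟙 𝟙) (tens_1 (W ⊗ 𝟙))))).
  by rewrite comp1m -compA -E; exact: eqm_irr.
apply: (iso_cancell (f := e1) (eqm_iso _)); rewrite E eqmM; symmetry; exact: eqm_id.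
Qed.

Lemma braid_unitl W : braid 𝟙 W = runitV W ∘ lunit W.
Proof.
have := @braid_nat R C _ _ W W (lunit 𝟙) (idm W).
rewrite braid_tensl.
have -> : idm 𝟙 ⊠ braid 𝟙 W = lunitV _ ∘ braid 𝟙 W ∘ lunit _.
  by rewrite -compA -tens1m compA lunitK comp1m.
have -> : braid 𝟙 W ⊠ idm 𝟙 = runitV _ ∘ braid 𝟙 W ∘ runit _.
  by rewrite -compA -tensm1 compA runitK comp1m.
eqm_chain; rewrite eqm_id comp1m -!compA => /(iso_cancell (braid_iso 𝟙 W)).
set e2 := eqm _; set e1 := eqm _; set e0 := eqm _ => E.
have {}E : e1 ∘ braid 𝟙 W = idm _.
  apply: (iso_cancelr (eqm_iso (etrans (esym (tensA 𝟙 𝟙 W)) (tens1 (𝟙 ⊗ W))))).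
  by rewrite comp1m -compA -E; exact: eqm_irr.
apply: (iso_cancell (f := e1) (eqm_iso _)); rewrite E eqmM; symmetry; exact: eqm_id.
Qed.

Lemma br_unitr W Z : br W 𝟙 Z ∘ W ◁ lunitV Z = lunitV (W ⊗ Z).
Proof. by rewrite !brE braid_unitr rtensM; eqm_chain; exact: eqm_irr. Qed.

Lemma br_unitl W Z : br 𝟙 W Z ∘ lunitV (W ⊗ Z) = W ◁ lunitV Z.
Proof. by rewrite !brE braid_unitl rtensM; eqm_chain; exact: eqm_irr. Qed.

Lemma br_unitr' W Z : lunit (W ⊗ Z) ∘ br W 𝟙 Z = W ◁ lunit Z.
Proof. by rewrite !brE braid_unitr rtensM; eqm_chain; exact: eqm_irr. Qed.

Lemma br_unitl' W Z : W ◁ lunit Z ∘ br 𝟙 W Z = lunit (W ⊗ Z).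
Proof. by rewrite !brE braid_unitl rtensM; eqm_chain; exact: eqm_irr. Qed.

Definition split A X Y (u : hom A (X ⊗ Y)) Z : hom (A ⊗ Z) (X ⊗ (Y ⊗ Z)) :=
  locked_with word_key (assocV X Y Z ∘ u ▷ Z).

Definition merge A X Y (u : hom (X ⊗ Y) A) Z : hom (X ⊗ (Y ⊗ Z)) (A ⊗ Z) :=
  locked_with word_key (u ▷ Z ∘ assoc X Y Z).

Definition cup X Y (k : hom 𝟙 (X ⊗ Y)) Z : hom Z (X ⊗ (Y ⊗ Z)) :=
  locked_with word_key (split k Z ∘ lunitV Z).

Definition cap X Y (e : hom (X ⊗ Y) 𝟙) Z : hom (X ⊗ (Y ⊗ Z)) Z :=
  locked_with word_key (lunit Z ∘ merge e Z).

Lemma splitE A X Y (u : hom A (X ⊗ Y)) Z : split u Z = assocV X Y Z ∘ u ▷ Z.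
Proof. by rewrite /split locked_withE. Qed.

Lemma mergeE A X Y (u : hom (X ⊗ Y) A) Z : merge u Z = u ▷ Z ∘ assoc X Y Z.
Proof. by rewrite /merge locked_withE. Qed.

Lemma cupE X Y (k : hom 𝟙 (X ⊗ Y)) Z : cup k Z = split k Z ∘ lunitV Z.
Proof. by rewrite /cup locked_withE. Qed.

Lemma capE X Y (e : hom (X ⊗ Y) 𝟙) Z : cap e Z = lunit Z ∘ merge e Z.
Proof. by rewrite /cap locked_withE. Qed.

Lemma split_nat A X Y (u : hom A (X ⊗ Y)) Z Z' (h : hom Z Z') :
  split u Z' ∘ A ◁ h = X ◁ (Y ◁ h) ∘ split u Z.
Proof.
by rewrite !splitE -compA interchange compA -tensm_id assocV_nat -compA.
Qed.

Lemma merge_nat A X Y (u : hom (X ⊗ Y) A) Z Z' (h : hom Z Z') :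
  merge u Z' ∘ X ◁ (Y ◁ h) = A ◁ h ∘ merge u Z.
Proof. by rewrite !mergeE -compA tensmA tensm_id compA interchange compA. Qed.

Lemma cup_nat X Y (k : hom 𝟙 (X ⊗ Y)) Z Z' (h : hom Z Z') :
  cup k Z' ∘ h = X ◁ (Y ◁ h) ∘ cup k Z.
Proof. by rewrite !cupE -compA lunitV_nat compA split_nat compA. Qed.

Lemma cap_nat X Y (e : hom (X ⊗ Y) 𝟙) Z Z' (h : hom Z Z') :
  cap e Z' ∘ X ◁ (Y ◁ h) = h ∘ cap e Z.
Proof. by rewrite !capE -compA merge_nat compA tens1m -compA. Qed.

(** A strand [W] slides past a vertex: the hexagon splits its crossing with [X ⊗ Y], and naturality
    moves [u] through. In this family of lemmas the suffix [r] means that [W] travels to the right,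
    [l] that it travels to the left. *)
Lemma cross_split_r W A X Y (u : hom A (X ⊗ Y)) Z :
  X ◁ br W Y Z ∘ br W X (Y ⊗ Z) ∘ W ◁ split u Z = split u (W ⊗ Z) ∘ br W A Z.
Proof. by rewrite !splitE ltensM compA -br_hexr -compA br_nat2 compA. Qed.

Lemma cross_split_l W A X Y (u : hom A (X ⊗ Y)) Z :
  br X W (Y ⊗ Z) ∘ X ◁ br Y W Z ∘ split u (W ⊗ Z) = W ◁ split u Z ∘ br A W Z.
Proof. by rewrite !splitE ltensM compA -br_hexl -compA br_nat1 compA. Qed.

Lemma cross_merge_r W A X Y (u : hom (X ⊗ Y) A) Z :
  merge u (W ⊗ Z) ∘ X ◁ br W Y Z ∘ br W X (Y ⊗ Z) = br W A Z ∘ W ◁ merge u Z.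
Proof.
rewrite !mergeE ltensM compA br_nat2.
have -> : br W (X ⊗ Y) Z =
    assoc X Y (W ⊗ Z) ∘ X ◁ br W Y Z ∘ br W X (Y ⊗ Z) ∘ W ◁ assocV X Y Z.
by rewrite -!compA (compA (X ◁ _)) -br_hexr !compA assocVK comp1m.
by rewrite -!compA -ltensM assocK tensm_id compm1.
Qed.

Lemma cross_merge_l W A X Y (u : hom (X ⊗ Y) A) Z :
  W ◁ merge u Z ∘ br X W (Y ⊗ Z) ∘ X ◁ br Y W Z = br A W Z ∘ merge u (W ⊗ Z).
Proof.
rewrite !mergeE ltensM compA br_nat1.
have -> : br (X ⊗ Y) W Z =
    W ◁ assoc X Y Z ∘ br X W (Y ⊗ Z) ∘ X ◁ br Y W Z ∘ assocV X Y (W ⊗ Z).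
  by rewrite -!compA (compA (br _ _ _)) -br_hexl !compA -ltensM assocVK tensm_id comp1m.
by rewrite -!compA assocK compm1.
Qed.

Lemma cross_cup_r W X Y (k : hom 𝟙 (X ⊗ Y)) Z :
  X ◁ br W Y Z ∘ br W X (Y ⊗ Z) ∘ W ◁ cup k Z = cup k (W ⊗ Z).
Proof. by rewrite !cupE ltensM compA cross_split_r -compA br_unitr. Qed.

Lemma cross_cup_l W X Y (k : hom 𝟙 (X ⊗ Y)) Z :
  br X W (Y ⊗ Z) ∘ X ◁ br Y W Z ∘ cup k (W ⊗ Z) = W ◁ cup k Z.
Proof. by rewrite !cupE ltensM compA cross_split_l -compA br_unitl. Qed.

Lemma cross_cap_r W X Y (e : hom (X ⊗ Y) 𝟙) Z :
  cap e (W ⊗ Z) ∘ X ◁ br W Y Z ∘ br W X (Y ⊗ Z) = W ◁ cap e Z.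
Proof. by rewrite !capE ltensM -2!compA (compA (merge _ _)) cross_merge_r compA br_unitr'. Qed.

Lemma cross_cap_l W X Y (e : hom (X ⊗ Y) 𝟙) Z :
  W ◁ cap e Z ∘ br X W (Y ⊗ Z) ∘ X ◁ br Y W Z = cap e (W ⊗ Z).
Proof. by rewrite !capE ltensM -2!compA (compA (_ ◁ merge _ _)) cross_merge_l compA br_unitl'. Qed.

(* Yang-Baxter: the strand X passes over the crossing of Y and W. *)
Lemma braid_rel X Y W Z :
  W ◁ br X Y Z ∘ br X W (Y ⊗ Z) ∘ X ◁ br Y W Z =
  br Y W (X ⊗ Z) ∘ Y ◁ br X W Z ∘ br X Y (W ⊗ Z).
Proof.
have E V : br Y W V = split (idm _) V ∘ merge (braid Y W) V.
  by rewrite brE splitE mergeE tensm_id compm1 compA.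
by rewrite !E ltensM compA cross_split_r -compA -cross_merge_r !compA.
Qed.

Definition EV X Z : hom (dual X ⊗ (X ⊗ Z)) Z := cap (ev X) Z.
Definition CO X Z : hom Z (X ⊗ (dual X ⊗ Z)) := cup (coev X) Z.
Definition EV' X Z : hom (X ⊗ (dual X ⊗ Z)) Z := cap (ev' X) Z.
Definition CO' X Z : hom Z (dual X ⊗ (X ⊗ Z)) := cup (coev' X) Z.

Lemma zigzagF X Z : X ◁ EV X Z ∘ CO X (X ⊗ Z) = idm (X ⊗ Z).
Proof.
have := congr1 (fun f => f ▷ Z) (zigzag X).
rewrite tensm_id => <-; rewrite /EV /CO capE cupE mergeE splitE !rtensM !ltensM.
rewrite lrtens rrtens; eqm_chain; eqm_cong.
Qed.

Lemma zigzagF_dual X Z :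
  EV X (dual X ⊗ Z) ∘ dual X ◁ CO X Z = idm (dual X ⊗ Z).
Proof.
have := congr1 (fun f => f ▷ Z) (zigzag_dual X).
rewrite tensm_id => <-; rewrite /EV /CO capE cupE mergeE splitE !rtensM !ltensM.
rewrite lrtens rrtens; eqm_chain; eqm_cong.
Qed.

Lemma CO'E X Z :
  CO' X Z = dual X ◁ (twist X ▷ Z) ∘ br X (dual X) Z ∘ CO X Z.
Proof.
rewrite /CO' /CO !cupE !splitE /coev' !rtensM brE lrtens.
by eqm_chain; rewrite !eqm_id comp1m compm1.
Qed.

Lemma EV'E X Z :
  EV' X Z = EV X Z ∘ br X (dual X) Z ∘ twist X ▷ (dual X ⊗ Z).
Proof.
rewrite /EV' /EV !capE !mergeE /ev' !rtensM brE rrtens.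
by eqm_chain; rewrite ?eqm_id ?comp1m ?compm1; eqm_cong.
Qed.

Lemma EV_nat X A B (h : hom A B) :
  EV X B ∘ dual X ◁ (X ◁ h) = h ∘ EV X A.
Proof. exact: cap_nat. Qed.

Lemma CO_nat X A B (h : hom A B) :
  CO X B ∘ h = X ◁ (dual X ◁ h) ∘ CO X A.
Proof. exact: cup_nat. Qed.

Lemma EV'_nat X A B (h : hom A B) :
  EV' X B ∘ X ◁ (dual X ◁ h) = h ∘ EV' X A.
Proof. exact: cap_nat. Qed.

Lemma CO'_nat X A B (h : hom A B) :
  CO' X B ∘ h = dual X ◁ (X ◁ h) ∘ CO' X A.
Proof. exact: cup_nat. Qed.

End Calculus.

(** * Partial traces *)

Section PartialTrace.
Variables (R : realType) (C : ribbonCategory R).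
Implicit Types A B X Y Z W : C.

(** The monodromy of 𝟙 with itself is trivial, so balancing makes this twist idempotent; it is also
    invertible. *)
Lemma twist_unit : twist 𝟙 = idm (𝟙 : C).
Proof.
have := twist_nat (lunit (𝟙 : C)); rewrite twist_tens braid_unitr.
have -> : twist 𝟙 ⊠ twist 𝟙 = twist 𝟙 ▷ 𝟙 ∘ 𝟙 ◁ twist (𝟙 : C).
  by rewrite -tensm_comp comp1m compm1.
rewrite (_ : twist 𝟙 ▷ 𝟙 = runitV _ ∘ twist 𝟙 ∘ runit _); last first.
  by rewrite -compA -tensm1 compA runitK comp1m.
rewrite (_ : 𝟙 ◁ twist 𝟙 = lunitV _ ∘ twist 𝟙 ∘ lunit _); last first.
  by rewrite -compA -tens1m compA lunitK comp1m.
have -> : runit 𝟙 = lunit (𝟙 : C) by exact: eqm_irr.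
have -> : runitV 𝟙 = lunitV (𝟙 : C) by exact: eqm_irr.
rewrite lunitK !comp1m !compA lunitVK comp1m -(compA (twist _)) lunitVK compm1.
move=> /(iso_cancelr (eqm_iso _)) E.
by apply: (iso_cancell (twist_iso 𝟙)); rewrite compm1.
Qed.

(** One of the two twists moves to the dual leg by [twist_dual]. The factors then form the twist of
    [X ⊗ dual X], which naturality along [coev X] reduces to the twist of 𝟙. *)
Lemma twist_coev X :
  braid (dual X) X ∘ braid X (dual X) ∘ twist X ▷ dual X ∘ twist X ▷ dual X
    ∘ coev X = coev X.
Proof.
rewrite -(compA _ (twist X ▷ _) (coev X)) twist_dual compA.
rewrite -(compA _ (twist X ▷ _)).
rewrite (_ : twist X ▷ _ ∘ _ = twist X ⊠ twist (dual X)); last first.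
  by rewrite -tensm_comp comp1m compm1.
by rewrite -twist_tens twist_nat twist_unit compm1.
Qed.

Lemma merge_br A X Y (e : hom (X ⊗ Y) A) Z :
  merge e Z ∘ br Y X Z = merge (e ∘ braid Y X) Z.
Proof.
by rewrite !mergeE brE rtensM !compA -(compA _ (assoc _ _ _)) assocVK compm1.
Qed.

Lemma br_split A X Y (u : hom A (X ⊗ Y)) Z :
  br X Y Z ∘ split u Z = split (braid X Y ∘ u) Z.
Proof.
by rewrite !splitE brE rtensM !compA -(compA _ (assoc _ _ _)) assocVK compm1.
Qed.

Lemma cap_br X Y (e : hom (X ⊗ Y) 𝟙) Z :
  cap e Z ∘ br Y X Z = cap (e ∘ braid Y X) Z.
Proof. by rewrite !capE -compA merge_br. Qed.

Lemma br_cup X Y (k : hom 𝟙 (X ⊗ Y)) Z :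
  br X Y Z ∘ cup k Z = cup (braid X Y ∘ k) Z.
Proof. by rewrite !cupE compA br_split. Qed.

Lemma tw_cup X Y (k : hom 𝟙 (X ⊗ Y)) (f : hom X X) Z :
  f ▷ (Y ⊗ Z) ∘ cup k Z = cup (f ▷ Y ∘ k) Z.
Proof.
by rewrite !cupE !splitE rtensM !compA -tensm_id -assocV_nat.
Qed.

(* CO' without its twist. *)
Definition wcup X Z := cup (braid X (dual X) ∘ coev X) Z.

Lemma wcupE X Z : br X (dual X) Z ∘ CO X Z = wcup X Z.
Proof. exact: br_cup. Qed.

Lemma CO'w X Z : CO' X Z = dual X ◁ (twist X ▷ Z) ∘ wcup X Z.
Proof. by rewrite CO'E -compA wcupE. Qed.

Lemma twist_wcup X Z :
  br (dual X) X Z ∘ dual X ◁ (twist X ▷ Z) ∘ dual X ◁ (twist X ▷ Z)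
    ∘ wcup X Z = CO X Z.
Proof.
rewrite -wcupE !compA (comp_eq2 (esym (br_nat1 _ _ _))) !compA.
rewrite (comp_eq2 (esym (br_nat1 _ _ _))).
rewrite /CO -!compA !tw_cup !br_cup; congr (cup _ Z).
by rewrite !compA twist_coev.
Qed.

Lemma br_iso X Y Z : is_iso (br X Y Z).
Proof.
have [g [gK Kg]] := braid_iso X Y.
exists (assocV X Y Z ∘ g ▷ Z ∘ assoc Y X Z); rewrite brE; split.
  rewrite !compA -(compA _ (assoc _ _ _)) assocVK compm1.
  by rewrite -(compA _ (g ▷ Z)) -rtensM gK tensm_id compm1 assocK.
rewrite !compA -(compA _ (assoc _ _ _)) assocVK compm1.
by rewrite -(compA _ (braid X Y ▷ Z)) -rtensM Kg tensm_id compm1 assocK.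
Qed.

Lemma rtens_iso W X Y (f : hom X Y) : is_iso f -> is_iso (f ▷ W).
Proof.
by case=> g [gK Kg]; exists (g ▷ W); rewrite -!rtensM gK Kg !tensm_id.
Qed.

(** The cap and cup obtained from the braiding and the twist make [dual X] a dual on the other side
    as well. *)
Lemma zigzag' X Z : EV' X (X ⊗ Z) ∘ X ◁ CO' X Z = idm (X ⊗ Z).
Proof.
set T := twist X ▷ Z.
(* [Q] is the zigzag stripped of its two twists. The zigzag itself is [T ∘ Q ∘ T], so it suffices
   that [Q] inverts [T ∘ T]. *)
pose Q := EV X (X ⊗ Z) ∘ br X (dual X) (X ⊗ Z) ∘ X ◁ wcup X Z.
have EQ : EV' X (X ⊗ Z) ∘ X ◁ CO' X Z = T ∘ Q ∘ T.
  rewrite EV'E CO'w ltensM !compA.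
  rewrite (comp_eq2 (interchange _ _)) -/T.
  rewrite !compA (comp_eq2 (br_natr _ _ _)) !compA EV_nat.
  by rewrite (comp_eq2 (interchange _ _)) !compA.
have [Bi [BiK KBi]] := br_iso X X Z.
have BiT : X ◁ T ∘ Bi = Bi ∘ twist X ▷ (X ⊗ Z).
  by rewrite -[LHS]comp1m -BiK !compA (comp_eq2 (br_nat2 _ _ _)) -!compA KBi compm1.
(* Sliding the outer strand through the cup trades its crossing for an inverse crossing [Bi],
   through which the twists can pass to the cup and be absorbed by [twist_wcup]. *)
have Q1 : Q = EV X (X ⊗ Z) ∘ dual X ◁ Bi ∘ wcup X (X ⊗ Z).
  rewrite /wcup -cross_cup_r -/(wcup X Z) !compA (comp_eq2 (esym (ltensM _ _ _))).
  by rewrite BiK tensm_id compm1.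
have TQ : T ∘ T ∘ Q = idm _.
  have [D [DK KD]] := br_iso (dual X) X (X ⊗ Z).
  have E0 : dual X ◁ (twist X ▷ (X ⊗ Z)) ∘ dual X ◁ (twist X ▷ (X ⊗ Z))
              ∘ wcup X (X ⊗ Z) = D ∘ CO X (X ⊗ Z).
    by rewrite -twist_wcup !compA DK comp1m.
  have E1 : EV X (X ⊗ Z) ∘ dual X ◁ Bi ∘ D = X ◁ EV X Z.
    rewrite {1}/EV -cross_cap_l -/(EV X Z) (comp_eq2 (esym (ltensM _ _ _))) KBi tensm_id.
    by rewrite compm1 -compA KD compm1.
  have BiT2 := etrans (ltens_eq2 (dual X) BiT) (ltensM _ _ _).
  rewrite Q1 !compA -(compA T T) -EV_nat !compA -EV_nat.
  by rewrite (comp_eq2 BiT2) !compA (comp_eq2 BiT2) !compA (comp_eq3 E0) !compA E1 zigzagF.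
apply: (iso_cancell (rtens_iso Z (twist_iso X))).
by rewrite EQ -/T (compA T) (compA T T Q) TQ comp1m compm1.
Qed.

Lemma zigzag'_dual X Z :
  dual X ◁ EV' X Z ∘ CO' X (dual X ⊗ Z) = idm (dual X ⊗ Z).
Proof.
have [D [DK KD]] := br_iso (dual X) X (dual X ⊗ Z).
have E0 : dual X ◁ (twist X ▷ (dual X ⊗ Z)) ∘ dual X ◁ (twist X ▷ (dual X ⊗ Z))
            ∘ wcup X (dual X ⊗ Z) = D ∘ CO X (dual X ⊗ Z).
  by rewrite -twist_wcup !compA DK comp1m.
have E1 : dual X ◁ cap (ev X ∘ braid X (dual X)) Z ∘ D =
          cap (ev X ∘ braid X (dual X)) (dual X ⊗ Z) ∘ X ◁ br (dual X) (dual X) Z.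
  by rewrite -cross_cap_r -!compA KD compm1.
rewrite EV'E CO'w !ltensM !compA (comp_eq3 E0).
rewrite -ltensM cap_br !compA E1 -cap_br -!(compA (cap _ _)).
by rewrite /CO !compA (comp_eq3 (cross_cup_l _ _ _)) -/(CO X Z) zigzagF_dual.
Qed.

Lemma cross_EV_r W X Z :
  EV X (W ⊗ Z) ∘ dual X ◁ br W X Z ∘ br W (dual X) (X ⊗ Z) = W ◁ EV X Z.
Proof. exact: cross_cap_r. Qed.

Lemma cross_CO_r W X Z :
  X ◁ br W (dual X) Z ∘ br W X (dual X ⊗ Z) ∘ W ◁ CO X Z = CO X (W ⊗ Z).
Proof. exact: cross_cup_r. Qed.

Definition ptrace X A B (h : hom (X ⊗ A) (X ⊗ B)) : hom A B :=
  EV X B ∘ dual X ◁ h ∘ CO' X A.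

(** The twist built into [CO'] leaves the loop by naturality. The two crossings then slide off the
    cap, and what is left is a zigzag. *)
Lemma kink X Z : ptrace (br X X Z) = twist X ▷ Z.
Proof.
rewrite /ptrace CO'E !compA (comp_eq2 (ltens_eq2 _ (br_nat1 _ _ _))) ltensM !compA EV_nat.
by rewrite (comp_eq3 (cross_EV_r _ _ _)) -compA zigzagF compm1.
Qed.

(** Dragging a leg around the cup [f] costs one crossing, together with the twist contained in
    [CO']. *)
Lemma FS_family X (f : hom 𝟙 (X ⊗ X)) Z :
  EV X (X ⊗ (X ⊗ Z)) ∘ dual X ◁ cup f (X ⊗ Z) ∘ CO' X Z =
  X ◁ (twist X ▷ Z) ∘ br X X Z ∘ cup f Z.
Proof.
rewrite CO'E !compA (comp_eq2 (ltens_eq2 _ (cup_nat _ _))) !ltensM !compA EV_nat.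
rewrite -(cross_cup_r X) !ltensM !compA (comp_eq2 (EV_nat _ _)) !compA.
rewrite (comp_eq2 (esym (br_natr _ _ _))) !compA (comp_eq3 (cross_EV_r _ _ _)).
by rewrite (comp_eq2 (esym (CO_nat _ _))) !compA (comp_eq2 (zigzagF _ _)) compm1.
Qed.

Lemma wcup_nat X A B (h : hom A B) :
  wcup X B ∘ h = dual X ◁ (X ◁ h) ∘ wcup X A.
Proof. exact: cup_nat. Qed.

Lemma cross_wcup_r W X Z :
  dual X ◁ br W X Z ∘ br W (dual X) (X ⊗ Z) ∘ W ◁ wcup X Z = wcup X (W ⊗ Z).
Proof. exact: cross_cup_r. Qed.

(* The nested cup is the cup of the pair X Y, braided over its dual Y* X*, up to
   the monodromy of X and Y that is part of the twist of X ⊗ Y. *)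
Lemma wcup_nest X Y V :
  dual Y ◁ wcup X (Y ⊗ V) ∘ wcup Y V =
  dual Y ◁ (dual X ◁ br Y X V) ∘ dual Y ◁ (dual X ◁ br X Y V)
    ∘ dual Y ◁ br X (dual X) (Y ⊗ V)
    ∘ br X (dual Y) (dual X ⊗ (Y ⊗ V)) ∘ X ◁ (dual Y ◁ br Y (dual X) V)
    ∘ X ◁ br Y (dual Y) (dual X ⊗ V) ∘ X ◁ CO Y (dual X ⊗ V) ∘ CO X V.
Proof.
rewrite (comp_eq2 (br_natr _ _ _)) !compA (comp_eq3 (ltens_eq3 _ (braid_rel _ _ _ _))).
rewrite !ltensM (comp_eq2 (ltens_eq2 _ (wcupE _ _))) !compA.
rewrite (comp_eq3 (cross_wcup_r _ _ _)) (comp_eq2 (wcup_nat _ _)) !compA.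
rewrite (comp_eq2 (ltens_eq2 _ (ltens_eq2 _ (wcupE _ _)))).
by rewrite (ltens_eq3 _ (cross_wcup_r _ _ _)).
Qed.

Lemma split_tens A X Y X' Y' (u : hom A (X ⊗ Y)) (f : hom X X') (g : hom Y Y') Z :
  f ▷ (Y' ⊗ Z) ∘ X ◁ (g ▷ Z) ∘ split u Z = split (f ⊠ g ∘ u) Z.
Proof.
rewrite !splitE rtensM ?compA assocV_nat; congr (_ ∘ _ ∘ _).
by rewrite -tensm_comp comp1m compm1.
Qed.

Lemma split_twist G X Y (u : hom G (X ⊗ Y)) Z :
  twist X ▷ (Y ⊗ Z) ∘ X ◁ (twist Y ▷ Z) ∘ br Y X Z ∘ br X Y Z ∘ split u Z =
  split u Z ∘ twist G ▷ Z.
Proof.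
rewrite -!compA !br_split compA split_tens !compA -(compA _ (braid Y X)).
rewrite (_ : _ ∘ (_ ∘ _) = twist (X ⊗ Y)); last first.
  by rewrite twist_tens compA -braid_nat -compA -braid_nat compA.
by rewrite twist_nat !splitE rtensM compA.
Qed.

(* Cyclicity: the transpose ut : Y* ⊗ X* -> G* of u carries the nested cap and
   cup of X and Y to those of G. For u = idm it says that the trace over X ⊗ Y
   is computed one factor at a time. *)
Lemma ptrace_split X Y G (u : hom G (X ⊗ Y)) Z Z' (h : hom (X ⊗ (Y ⊗ Z)) (G ⊗ Z')) :
  ptrace (ptrace (split u Z' ∘ h)) = ptrace (h ∘ split u Z).
Proof.
(* [s] is [u] placed on a cup of [G]; bending its leg X, and then its leg Y, by caps gives [r] and
   the transpose [ut]. The bodies are cleared so that only the equations below unfold them. *)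
pose s V := split u (dual G ⊗ V) ∘ CO G V.
pose r V := EV X (Y ⊗ (dual G ⊗ V)) ∘ dual X ◁ s V.
pose ut V := EV Y (dual G ⊗ V) ∘ dual Y ◁ r V.
have sE V : s V = split u (dual G ⊗ V) ∘ CO G V by [].
have rE V : r V = EV X (Y ⊗ (dual G ⊗ V)) ∘ dual X ◁ s V by [].
have utE V : ut V = EV Y (dual G ⊗ V) ∘ dual Y ◁ r V by [].
clearbody ut; clearbody r; clearbody s.
have s_nat A B (k : hom A B) : s B ∘ k = X ◁ (Y ◁ (dual G ◁ k)) ∘ s A.
  by rewrite !sE -compA CO_nat !compA split_nat.
have r_nat A B (k : hom A B) : r B ∘ dual X ◁ k = Y ◁ (dual G ◁ k) ∘ r A.
  by rewrite !rE -compA -ltensM s_nat ltensM !compA EV_nat.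
have ut_nat A B (k : hom A B) :
    ut B ∘ dual Y ◁ (dual X ◁ k) = dual G ◁ k ∘ ut A.
  by rewrite !utE -compA -ltensM r_nat ltensM !compA EV_nat.
have EV_ut V : EV G V ∘ ut (G ⊗ V) =
    EV Y V ∘ dual Y ◁ EV X (Y ⊗ V) ∘ dual Y ◁ (dual X ◁ split u V).
  rewrite utE rE sE !compA -EV_nat -!compA; congr (_ ∘ _).
  rewrite -!ltensM; congr (_ ◁ _).
  rewrite !compA -EV_nat -!compA; congr (_ ∘ _).
  rewrite -!ltensM; congr (_ ◁ _).
  by rewrite !compA -split_nat -!compA zigzagF compm1.
have s_br W V : s (W ⊗ V) = X ◁ (Y ◁ br W (dual G) V)
    ∘ X ◁ br W Y (dual G ⊗ V) ∘ br W X (Y ⊗ (dual G ⊗ V)) ∘ W ◁ s V.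
  rewrite !sE -cross_CO_r !compA split_nat (comp_eq2 (esym (cross_split_r _ _ _))).
  by rewrite ltensM !compA.
have r_br W V : r (W ⊗ V) ∘ br W (dual X) V =
    Y ◁ br W (dual G) V ∘ br W Y (dual G ⊗ V) ∘ W ◁ r V.
  rewrite !rE s_br !ltensM !compA EV_nat (comp_eq2 (EV_nat _ _)) !compA.
  rewrite (comp_eq2 (esym (br_natr _ _ _))) !compA.
  by rewrite (comp_eq3 (cross_EV_r _ _ _)).
have ut_br W V : ut (W ⊗ V) ∘ dual Y ◁ br W (dual X) V
      ∘ br W (dual Y) (dual X ⊗ V) =
    br W (dual G) V ∘ W ◁ ut V.
  rewrite !utE (comp_eq2 (ltens_eq2 _ (r_br _ _))) !ltensM !compA EV_nat.
  rewrite (comp_eq2 (esym (br_natr _ _ _))) !compA.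
  by rewrite (comp_eq3 (cross_EV_r _ _ _)).
have ut_CO V : X ◁ (Y ◁ ut V) ∘ X ◁ CO Y (dual X ⊗ V) ∘ CO X V = s V.
  rewrite !utE !ltensM (comp_eq2 (ltens_eq2 _ (esym (CO_nat _ _)))) !ltensM !compA.
  rewrite -(ltensM X (Y ◁ _)) zigzagF tensm_id comp1m.
  rewrite rE ltensM (comp_eq2 (esym (CO_nat _ _))) compA.
  by rewrite zigzagF comp1m.
(* This is the cup half, [EV_ut] being the cap half. After [wcup_nest], [ut] slides through the
   crossings and meets the cups as [s]; the leftover monodromy and twists form the twist of [X ⊗ Y],
   which [u] turns into that of [G]. *)
have star V : ut (X ⊗ (Y ⊗ V)) ∘ dual Y ◁ CO' X (Y ⊗ V) ∘ CO' Y V =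
    dual G ◁ split u V ∘ CO' G V.
  rewrite !CO'w !ltensM !compA (comp_eq2 (ltens_eq2 _ (wcup_nat _ _))) !ltensM !compA.
  rewrite (comp_eq2 (wcup_nest _ _ _)) !compA.
  rewrite ut_nat; do 3 rewrite (comp_eq2 (ut_nat _ _ _)) !compA.
  rewrite (comp_eq3 (ut_br _ _)) !compA (comp_eq3 (ltens_eq3 _ (ut_br _ _))) !ltensM !compA.
  rewrite (comp_eq3 (ut_CO _)) sE !compA (comp_eq3 (cross_split_l _ _ _)) !compA.
  rewrite -!ltensM split_twist ltensM -!compA; congr (_ ∘ _).
  by rewrite wcupE.
rewrite /ptrace !ltensM !compA -EV_ut (comp_eq2 (ut_nat _ _ _)) !compA.
by rewrite (comp_eq3 (star _)) !compA.
Qed.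

End PartialTrace.

(** * Schur's lemma and dual bases *)

Section Linear.
Variables (R : realType) (C : linearCategory R).
Implicit Types A B X Y Z W : C.

Lemma compDl X Y Z (g g' : hom Y Z) (f : hom X Y) :
  (g + g') ∘ f = g ∘ f + g' ∘ f.
Proof. by rewrite -[g]scale1r comp_linearl !scale1r. Qed.

Lemma compDr X Y Z (g : hom Y Z) (f f' : hom X Y) :
  g ∘ (f + f') = g ∘ f + g ∘ f'.
Proof. by rewrite -[f]scale1r comp_linearr !scale1r. Qed.

Lemma comp0l X Y Z (f : hom X Y) : (0 : hom Y Z) ∘ f = 0.
Proof. by apply: (addrI (0 ∘ f)); rewrite -compDl !addr0. Qed.

Lemma comp0r X Y Z (g : hom Y Z) : g ∘ (0 : hom X Y) = 0.
Proof. by apply: (addrI (g ∘ 0)); rewrite -compDr !addr0. Qed.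

Lemma compZl X Y Z (a : R[i]) (g : hom Y Z) (f : hom X Y) :
  (a *: g) ∘ f = a *: (g ∘ f).
Proof. by rewrite -[a *: g]addr0 comp_linearl comp0l addr0. Qed.

Lemma compZr X Y Z (a : R[i]) (g : hom Y Z) (f : hom X Y) :
  g ∘ (a *: f) = a *: (g ∘ f).
Proof. by rewrite -[a *: f]addr0 comp_linearr comp0r addr0. Qed.

Lemma compBr X Y Z (g : hom Y Z) (f f' : hom X Y) :
  g ∘ (f - f') = g ∘ f - g ∘ f'.
Proof. by rewrite compDr -scaleN1r compZr scaleN1r. Qed.

Lemma compBl X Y Z (g g' : hom Y Z) (f : hom X Y) :
  (g - g') ∘ f = g ∘ f - g' ∘ f.
Proof. by rewrite compDl -scaleN1r compZl scaleN1r. Qed.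

Lemma comp_suml X Y Z (I : finType) (P : pred I) (g : I -> hom Y Z)
    (f : hom X Y) :
  (\sum_(i | P i) g i) ∘ f = \sum_(i | P i) (g i ∘ f).
Proof. exact: (big_morph (fun g => g ∘ f) (fun _ _ => compDl _ _ _) (comp0l _ _)). Qed.

Lemma comp_sumr X Y Z (I : finType) (P : pred I) (g : hom Y Z)
    (f : I -> hom X Y) :
  g ∘ (\sum_(i | P i) f i) = \sum_(i | P i) (g ∘ f i).
Proof. exact: (big_morph (fun f => g ∘ f) (fun _ _ => compDr _ _ _) (comp0r _ _)). Qed.

Lemma scalar_ofZ X (z : R[i]) : idm X <> 0 -> scalar_of (z *: idm X) = z.
Proof.
move=> nz; rewrite /scalar_of linearZ /=.
have fr : free [tuple idm X] by rewrite seq1_free; apply/eqP.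
have -> : coord [tuple idm X] ord0 (idm X) = 1 by exact: (coord_free ord0 ord0 fr).
exact: mulr1.
Qed.

(** Composition with [f] is an endomorphism of the nonzero finite-dimensional space [hom X X] over
    an algebraically closed field. *)
Lemma eigenvector X (f : hom X X) :
  idm X <> 0 -> exists (c : R[i]) (g : hom X X), g <> 0 /\ f ∘ g = c *: g.
Proof.
move=> nz; pose V := hom X X; pose b := vbasis {:V}.
pose M := \matrix_(i < \dim {:V}, j < \dim {:V}) coord b j (f ∘ b`_i).
have dpos : (0 < \dim {:V})%N.
  rewrite lt0n dimv_eq0; apply/negP => /eqP V0; apply: nz; apply/eqP.
  by rewrite -memv0 -V0 memvf.
have [c /eigenvalueP[v vM vnz]] := eigenvalue_closed M dpos.
exists c, (\sum_i v 0 i *: b`_i); split.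
  move=> g0; case/eqP: vnz; apply/rowP => i; rewrite mxE.
  have /freeP := basis_free (vbasisP {:V}); apply.
  by rewrite -[RHS]g0; apply: eq_bigr => j _.
rewrite comp_sumr scaler_sumr.
transitivity (\sum_j (v *m M) 0 j *: b`_j); last first.
  by apply: eq_bigr => j _; rewrite vM mxE scalerA.
transitivity (\sum_i v 0 i *: \sum_j M i j *: b`_j).
  apply: eq_bigr => i _; rewrite compZr; congr (_ *: _).
  rewrite [LHS](coord_vbasis (memvf _)); apply: eq_bigr => j _.
  by rewrite mxE.
under eq_bigr => i _ do rewrite scaler_sumr.
rewrite exchange_big; apply: eq_bigr => j _ /=.
by rewrite mxE scaler_suml; apply: eq_bigr => i _; rewrite scalerA.
Qed.

Hypothesis Cab : is_abelian C.

(** The kernel of [f] is a mono into X, hence zero or invertible. If invertible, [f] is 0; if zero,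
    [f] is a mono into the simple object Y. *)
Lemma schur0 X Y (f : hom X Y) : is_simple X -> is_simple Y -> f = 0 \/ is_iso f.
Proof.
move=> [_ sX] [_ sY]; have [_ [/(_ X Y f)[K [k [fk kP]]] _ _ _]] := Cab.
have kmono : is_mono k.
  move=> Z g h E; have fkg : f ∘ (k ∘ g) = 0 by rewrite compA fk comp0l.
  have [l [_ lU]] := kP Z (k ∘ g) fkg.
  by rewrite -(lU g) // -(lU h).
have [k0|[k' [_ kk']]] := sX _ k kmono; last first.
  by left; rewrite -[f]compm1 -kk' compA fk comp0l.
apply: sY => Z g h E; apply/eqP; rewrite -subr_eq0; apply/eqP.
have fgh : f ∘ (g - h) = 0 by rewrite compBr E subrr.
by have [l [<- _]] := kP Z (g - h) fgh; rewrite k0 comp0l.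
Qed.

Lemma schur X (f : hom X X) : is_simple X -> exists c, f = c *: idm X.
Proof.
move=> sX; have [c [g [gnz E]]] := eigenvector f (proj1 sX).
exists c; apply/eqP; rewrite -subr_eq0; apply/eqP.
have [//|[k [kK _]]] := schur0 (f - c *: idm X) sX sX.
case: gnz; rewrite -[g]comp1m -kK -compA.
by rewrite compBl compZl comp1m E subrr comp0r.
Qed.

Lemma schurE X (f : hom X X) : is_simple X -> f = scalar_of f *: idm X.
Proof.
move=> sX; have [c ->] := schur f sX.
by rewrite scalar_ofZ //; exact: (proj1 sX).
Qed.

End Linear.

Section Tensor.
Variables (R : realType) (C : monoidalCategory R).
Implicit Types A B X Y Z W : C.

Lemma tensDl X X' Y Y' (f f' : hom X X') (g : hom Y Y') :
  (f + f') ⊠ g = f ⊠ g + f' ⊠ g.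
Proof. by rewrite -[f]scale1r tensm_linearl !scale1r. Qed.

Lemma tensDr X X' Y Y' (f : hom X X') (g g' : hom Y Y') :
  f ⊠ (g + g') = f ⊠ g + f ⊠ g'.
Proof. by rewrite -[g]scale1r tensm_linearr !scale1r. Qed.

Lemma tens0l X X' Y Y' (g : hom Y Y') : (0 : hom X X') ⊠ g = 0.
Proof. by apply: (addrI (0 ⊠ g)); rewrite -tensDl !addr0. Qed.

Lemma tens0r X X' Y Y' (f : hom X X') : f ⊠ (0 : hom Y Y') = 0.
Proof. by apply: (addrI (f ⊠ 0)); rewrite -tensDr !addr0. Qed.

Lemma tensZl X X' Y Y' a (f : hom X X') (g : hom Y Y') :
  (a *: f) ⊠ g = a *: (f ⊠ g).
Proof. by rewrite -[a *: f]addr0 tensm_linearl tens0l addr0. Qed.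

Lemma tensZr X X' Y Y' a (f : hom X X') (g : hom Y Y') :
  f ⊠ (a *: g) = a *: (f ⊠ g).
Proof. by rewrite -[a *: g]addr0 tensm_linearr tens0r addr0. Qed.

Lemma tens_sumr X X' Y Y' (I : finType) (P : pred I) (f : hom X X')
    (g : I -> hom Y Y') :
  f ⊠ (\sum_(i | P i) g i) = \sum_(i | P i) (f ⊠ g i).
Proof. exact: (big_morph (fun g => f ⊠ g) (fun _ _ => tensDr _ _ _) (tens0r _ _ _)). Qed.

End Tensor.

Lemma dim_inj (K : fieldType) (V W : vectType K) (f : V -> W) :
  (forall a x y, f (a *: x + y) = a *: f x + f y) -> injective f ->
  (\dim {:V} <= \dim {:W})%N.
Proof.
move=> fL fI; pose fl : {linear V -> W} := HB.pack f (GRing.isLinear.Build K V W _ f fL).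
have k0 : lker (linfun fl) == 0%VS.
  apply/lker0P => x y; rewrite !lfunE; exact: fI.
by rewrite -(limg_dim_eq (f := linfun fl)) ?dimvS ?subvf// (eqP k0) capv0.
Qed.
Lemma dim_bij (K : fieldType) (V W : vectType K) (f : V -> W) (g : W -> V) :
  (forall a x y, f (a *: x + y) = a *: f x + f y) ->
  cancel f g -> cancel g f -> \dim {:V} = \dim {:W}.
Proof.
move=> fL fK gK; apply/eqP; rewrite eqn_leq (dim_inj fL (can_inj fK)) /=.
apply: dim_inj (can_inj gK) => a x y.
by apply: (can_inj fK); rewrite fL !gK.
Qed.

Section Semisimple.
Variables (R : realType) (C : linearCategory R).
Hypotheses (Cab : is_abelian C) (Css : is_semisimple C).
Implicit Types A B X Y Z W G : C.

Lemma isotypic_decomposition G Z : is_simple G ->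
  exists n (u : 'I_n -> hom G Z) (v : 'I_n -> hom Z G),
    forall g : hom G Z, g = \sum_(i < n) u i ∘ (v i ∘ g).
Proof.
move=> sG; have [n [F [sF [inj [proj [_ _ ip]]]]]] := Css Z.
have /choice[uv uvP] (k : 'I_n) : exists uv : hom G Z * hom Z G,
    forall g : hom G Z, uv.1 ∘ (uv.2 ∘ g) = inj k ∘ (proj k ∘ g).
  have [[h [h' [hK Kh]]]|nG] := pselect (isomorphic G (F k)).
    exists (inj k ∘ h, h' ∘ proj k) => g /=.
    by rewrite !compA -(compA (inj k) h h') Kh compm1.
  (* Summands not isomorphic to [G] keep their index with zero morphisms; no nonzero [g] reaches
     them. *)
  exists (0, 0) => g /=; rewrite comp0l.
  have [->|i] := schur0 Cab (proj k ∘ g) sG (sF k); first by rewrite comp0r.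
  by case: nG; exists (proj k ∘ g).
exists n, (fun i => (uv i).1), (fun i => (uv i).2) => g.
under eq_bigr => i _ do rewrite uvP compA.
by rewrite -comp_suml ip comp1m.
Qed.

(** Applied to coordinate forms, this produces the dual bases on which all trace computations
    rest. *)
Lemma linear_form_mor G Z (phi : hom G Z -> R[i]) : is_simple G ->
  (forall a f g, phi (a *: f + g) = a * phi f + phi g) ->
  exists v : hom Z G, forall g, v ∘ g = phi g *: idm G.
Proof.
move=> sG phiL; have [n [u [v uvP]]] := isotypic_decomposition Z sG.
have phi0 : phi 0 = 0.
  by have := phiL (-1) 0 0; rewrite scaler0 addr0 mulN1r addNr.
(* By Schur each [v i ∘ g] is a scalar [l i], so [g] is the combination of the [u i] with these
   coefficients. *)
exists (\sum_i phi (u i) *: v i) => g.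
pose l i := scalar_of (v i ∘ g).
have vg i : v i ∘ g = l i *: idm G by exact: schurE.
rewrite {2}[g]uvP comp_suml.
have -> : phi (\sum_i u i ∘ (v i ∘ g)) = \sum_i l i * phi (u i).
  elim/big_rec2: _ => [//|i y x _ <-].
  by rewrite vg compZr compm1 phiL.
rewrite scaler_suml; apply: eq_bigr => i _.
by rewrite compZl vg scalerA mulrC.
Qed.

Variables (m : nat) (S : 'I_m -> C).
Hypothesis HS : represents_simples S.

Lemma simpleS k : is_simple (S k).
Proof. by case: HS. Qed.

Lemma nzS k : idm (S k) <> 0.
Proof. by case: (simpleS k). Qed.

Lemma schur_neq k l (f : hom (S k) (S l)) : k != l -> f = 0.
Proof.
move=> kl; have [//|i] := schur0 Cab f (simpleS k) (simpleS l).
by case: HS => _ inj _; case/eqP: kl; apply: inj; exists f.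
Qed.

Lemma simple_sep Z W (f f' : hom Z W) :
  (forall k (g : hom (S k) Z), f ∘ g = f' ∘ g) -> f = f'.
Proof.
move=> E; have [n [F [sF [inj [proj [_ _ ip]]]]]] := Css Z.
rewrite -[f]compm1 -[f']compm1 -ip !comp_sumr; apply: eq_bigr => k _.
case: HS => _ _ /(_ _ (sF k))[l [h [h' [hK _]]]].
by rewrite -(compm1 (inj k)) -hK !compA -(compA f) -(compA f') E.
Qed.

Definition hom_basis k Z (i : 'I_(\dim {: hom (S k) Z})) : hom (S k) Z :=
  (vbasis {: hom (S k) Z})`_i.

Lemma hom_dual_basis_ex k Z (i : 'I_(\dim {: hom (S k) Z})) :
  exists v : hom Z (S k), forall g,
    v ∘ g = coord (vbasis {: hom (S k) Z}) i g *: idm (S k).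
Proof.
by apply: linear_form_mor (simpleS k) _ => a f g; rewrite linearP.
Qed.

Definition hom_dual_basis k Z (i : 'I_(\dim {: hom (S k) Z})) : hom Z (S k) :=
  sval (cid (hom_dual_basis_ex i)).

Lemma hom_dual_basisE k Z (i : 'I_(\dim {: hom (S k) Z})) (g : hom (S k) Z) :
  hom_dual_basis i ∘ g = coord (vbasis {: hom (S k) Z}) i g *: idm (S k).
Proof. by rewrite /hom_dual_basis; case: cid => v /=. Qed.

Lemma hom_basisE k Z (g : hom (S k) Z) :
  g = \sum_i coord (vbasis {: hom (S k) Z}) i g *: hom_basis i.
Proof. exact: coord_vbasis (memvf g). Qed.

Lemma hom_dual_basis_hom_basis k Z (i j : 'I_(\dim {: hom (S k) Z})) :
  hom_dual_basis i ∘ hom_basis j = (i == j)%:R *: idm (S k).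
Proof.
by rewrite hom_dual_basisE coord_free ?(basis_free (vbasisP _))// eq_sym.
Qed.

Lemma hom_dual_basis_neq k l Z (i : 'I_(\dim {: hom (S k) Z})) (g : hom (S l) Z) :
  l != k -> hom_dual_basis i ∘ g = 0.
Proof. exact: schur_neq. Qed.

Lemma resolution Z : \sum_k \sum_i hom_basis i ∘ hom_dual_basis (k := k) i = idm Z.
Proof.
apply: simple_sep => k g; rewrite comp1m comp_suml (bigD1 k)//= [X in _ + X]big1 => [|l lk].
  rewrite addr0 comp_suml [RHS]hom_basisE; apply: eq_bigr => i _.
  by rewrite -compA hom_dual_basisE compZr compm1.
rewrite comp_suml big1// => i _.
by rewrite -compA hom_dual_basis_neq ?comp0r// eq_sym.
Qed.

Lemma hom_dual_basisP k Z (v : hom Z (S k)) :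
  v = \sum_i scalar_of (v ∘ hom_basis i) *: hom_dual_basis i.
Proof.
rewrite -[LHS]compm1 -resolution comp_sumr (bigD1 k)//= [X in _ + X]big1 => [|l lk].
  rewrite addr0 comp_sumr; apply: eq_bigr => i _; rewrite compA.
  have -> : v ∘ hom_basis i = scalar_of (v ∘ hom_basis i) *: idm (S k).
    by apply: schurE => //; exact: simpleS.
  by rewrite compZl comp1m scalar_ofZ//; exact: nzS.
rewrite comp_sumr big1// => i _.
by rewrite compA (schur_neq (v ∘ hom_basis i)) ?comp0l.
Qed.

Lemma dim_hom_sym k Z : \dim {: hom Z (S k)} = \dim {: hom (S k) Z}.
Proof.
pose b := [tuple hom_dual_basis i | i < \dim {: hom (S k) Z}].
have bE (i : 'I_(\dim {: hom (S k) Z})) : b`_i = hom_dual_basis i.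
  by rewrite -tnth_nth tnth_mktuple.
have fb : free b.
  apply/(freeP (X := b)) => c E i; have := congr1 (fun v => v ∘ hom_basis i) E.
  rewrite comp0l comp_suml (bigD1 i)//= [X in _ + X]big1 => [|j ji].
    rewrite addr0 compZl bE hom_dual_basis_hom_basis eqxx scale1r => /eqP.
    by rewrite scaler_eq0 => /orP[/eqP//|/eqP/nzS].
  by rewrite compZl bE hom_dual_basis_hom_basis (negPf ji) scale0r scaler0.
have sb : (fullv <= <<b>>)%VS.
  apply/subvP => v _; rewrite [v]hom_dual_basisP; apply: memv_suml => i _.
  by apply/memvZ/memv_span; rewrite -bE mem_nth ?size_tuple.
have bB : basis_of fullv b by rewrite /basis_of fb andbT eqEsubv subvf sb.
by rewrite -(size_basis bB).
Qed.

Lemma mor_to_simple_eq0 G Z (v : hom Z G) : is_simple G ->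
  (forall u : hom G Z, v ∘ u = 0) -> v = 0.
Proof.
move=> sG v0; apply: simple_sep => k u; rewrite comp0l.
have [//|[h [hK Kh]]] := schur0 Cab (v ∘ u) (simpleS k) sG.
by rewrite -[LHS]compm1 -hK (compA (v ∘ u) h) -(compA v u h) v0 comp0l.
Qed.

End Semisimple.

(** * Full traces and their cyclicity *)

Section Word.
Variables (R : realType) (C : ribbonCategory R).
Implicit Types A B X Y Z W G : C.

Definition act2 X Y X' Y' (f : hom (X ⊗ Y) (X' ⊗ Y')) Z :
    hom (X ⊗ (Y ⊗ Z)) (X' ⊗ (Y' ⊗ Z)) :=
  locked_with word_key (assocV X' Y' Z ∘ f ▷ Z ∘ assoc X Y Z).

Lemma act2E X Y X' Y' (f : hom (X ⊗ Y) (X' ⊗ Y')) Z :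
  act2 f Z = assocV X' Y' Z ∘ f ▷ Z ∘ assoc X Y Z.
Proof. by rewrite /act2 locked_withE. Qed.

Lemma act2M X Y X' Y' X'' Y'' (g : hom (X' ⊗ Y') (X'' ⊗ Y''))
    (f : hom (X ⊗ Y) (X' ⊗ Y')) Z : act2 (g ∘ f) Z = act2 g Z ∘ act2 f Z.
Proof.
rewrite !act2E rtensM !compA -(compA _ (assoc X' Y' Z) (assocV _ _ _)).
by rewrite assocVK compm1.
Qed.

Lemma act2_br X Y Z : act2 (braid X Y) Z = br X Y Z.
Proof. by rewrite act2E brE. Qed.

Lemma act2_split_merge X Y X' Y' A (g : hom A (X' ⊗ Y')) (f : hom (X ⊗ Y) A) Z :
  act2 (g ∘ f) Z = split g Z ∘ merge f Z.
Proof. by rewrite act2E splitE mergeE rtensM !compA. Qed.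

Lemma act2_nat X Y X' Y' (f : hom (X ⊗ Y) (X' ⊗ Y')) Z Z' (h : hom Z Z') :
  act2 f Z' ∘ X ◁ (Y ◁ h) = X' ◁ (Y' ◁ h) ∘ act2 f Z.
Proof.
have E V : act2 f V = split (idm _) V ∘ merge f V.
  by rewrite act2E splitE mergeE tensm_id compm1 compA.
by rewrite !E -compA merge_nat !compA split_nat.
Qed.

Lemma act2_ltens X Y Y' (f : hom Y Y') Z : act2 (X ◁ f) Z = X ◁ (f ▷ Z).
Proof. by rewrite act2E assocV_nat -compA assocK compm1. Qed.

Lemma merge_spK X Y G (f : hom (X ⊗ Y) G) (g : hom G (X ⊗ Y)) Z :
  merge f Z ∘ split g Z = (f ∘ g) ▷ Z.
Proof.
by rewrite mergeE splitE rtensM !compA -(compA _ (assoc _ _ _)) assocVK compm1.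
Qed.

Lemma cap_act2 X Y X' Y' (f : hom (X ⊗ Y) (X' ⊗ Y')) (e : hom (X' ⊗ Y') 𝟙) Z :
  cap e Z ∘ act2 f Z = cap (e ∘ f) Z.
Proof.
rewrite !capE !mergeE act2E rtensM !compA -(compA _ (assoc _ _ _) (assocV _ _ _)).
by rewrite assocVK compm1.
Qed.

Lemma cap_cup X Y (e : hom (X ⊗ Y) 𝟙) (k : hom 𝟙 (X ⊗ Y)) Z :
  cap e Z ∘ cup k Z = lunit Z ∘ (e ∘ k) ▷ Z ∘ lunitV Z.
Proof. by rewrite capE cupE !compA -(compA _ (merge _ _)) merge_spK. Qed.

(** The loop is closed on the left, as in [ptrace], whereas [spherical_trace] closes it on the
    right. *)
Definition trace_mor X (f : hom X X) : hom 𝟙 𝟙 := ev X ∘ dual X ◁ f ∘ coev' X.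

Lemma ptrace_rtens X (f : hom X X) Z :
  ptrace (f ▷ Z) = lunit Z ∘ trace_mor f ▷ Z ∘ lunitV Z.
Proof. by rewrite /ptrace -act2_ltens cap_act2 cap_cup. Qed.

(** Sphericality: the crossing and the twist contained in [ev'] move along the loop, past [f], and
    turn [coev] into [coev']. *)
Lemma trace_mor_spherical X (f : hom X X) :
  ev' X ∘ (f ⊠ idm (dual X)) ∘ coev X = trace_mor f.
Proof.
rewrite /ev' /trace_mor /coev' !compA -(compA _ (dual X ◁ f)) -ltensM.
rewrite -(compA _ _ (braid _ _)) -2!(compA (ev X)).
rewrite -(twist_nat f) -braid_nat rtensM.
by rewrite !compA.
Qed.

Lemma spherical_traceE X (f : hom X X) : spherical_trace f = scalar_of (trace_mor f).
Proof. by rewrite /spherical_trace trace_mor_spherical. Qed.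

Lemma cap_rtens X Y (e : hom (X ⊗ Y) 𝟙) A Z :
  cap e (A ⊗ Z) =
  cap e A ▷ Z ∘ assoc X (Y ⊗ A) Z ∘ X ◁ assoc Y A Z.
Proof.
rewrite !capE !mergeE !rtensM rrtens; eqm_chain.
by rewrite ?eqm_id ?compm1; eqm_cong.
Qed.

Lemma cup_rtens X Y (k : hom 𝟙 (X ⊗ Y)) A Z :
  cup k (A ⊗ Z) = X ◁ assocV Y A Z ∘ assocV X (Y ⊗ A) Z ∘ cup k A ▷ Z.
Proof.
rewrite !cupE !splitE !rtensM rrtens; eqm_chain.
by rewrite ?eqm_id ?comp1m; eqm_cong.
Qed.

Lemma ptrace_act2 X Y Y' (f : hom (X ⊗ Y) (X ⊗ Y')) Z : ptrace (act2 f Z) = ptrace f ▷ Z.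
Proof.
rewrite /ptrace /EV /CO' cap_rtens cup_rtens act2E !rtensM !ltensM lrtens.
eqm_chain.
by rewrite ?eqm_id ?comp1m ?compm1; eqm_cong.
Qed.

Lemma trace_mor_ptrace X Y G (u : hom G (X ⊗ Y)) (h : hom (X ⊗ Y) G) :
  trace_mor (ptrace (u ∘ h)) = trace_mor (h ∘ u).
Proof.
have := ptrace_split u (merge h 𝟙); rewrite -act2_split_merge ptrace_act2 merge_spK !ptrace_rtens.
rewrite -!compA => /(iso_cancell (eqm_iso _)) /(iso_cancelr (eqm_iso _)).
move=> E; rewrite -[LHS]comp1m -[RHS]comp1m -runitVK -!compA !runitV_nat.
by rewrite E.
Qed.

Lemma trace_mor_prod X Y (f : hom (X ⊗ Y) (X ⊗ Y)) : trace_mor (ptrace f) = trace_mor f.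
Proof. by rewrite -[f in LHS]comp1m trace_mor_ptrace compm1. Qed.

Lemma tr1C X Y (f : hom X Y) (g : hom Y X) : trace_mor (f ∘ g) = trace_mor (g ∘ f).
Proof.
have E Y1 Y2 (e : Y1 = Y2) (h : hom X Y1) (k : hom Y1 X) :
    trace_mor (h ∘ k) = trace_mor (k ∘ h) -> trace_mor (eqm e ∘ h ∘ (k ∘ eqm (esym e))) =
    trace_mor (k ∘ eqm (esym e) ∘ (eqm e ∘ h)).
  by case: _ / e; rewrite /= !comp1m !compm1.
(* [trace_mor_ptrace] concerns a tensor product, so [Y] is replaced by the equal object [𝟙 ⊗ Y]; [E]
   transports the identity back. *)
have := E _ _ (tens1 Y) (lunitV Y ∘ f) (g ∘ lunit Y).
rewrite -/(lunitV Y) -/(lunit Y) -(compA g (lunit Y) (lunitV Y)) lunitVK.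
by rewrite compm1 (compA (lunit Y)) lunitVK comp1m; apply; rewrite -trace_mor_prod trace_mor_ptrace.
Qed.

End Word.

(** * Monodromy and rotation *)

Section Monodromy.
Variables (R : realType) (C : ribbonCategory R).
Implicit Types A B X Y Z W G : C.

Definition monodromy X Y : hom (X ⊗ Y) (X ⊗ Y) := braid Y X ∘ braid X Y.

Lemma monodromy_nat X X' Y Y' (f : hom X X') (g : hom Y Y') :
  monodromy X' Y' ∘ (f ⊠ g) = (f ⊠ g) ∘ monodromy X Y.
Proof. by rewrite /monodromy -compA braid_nat compA braid_nat compA. Qed.

Lemma braid_hexr X Y Z :
  braid X (Y ⊗ Z) = assoc Y Z X ∘ Y ◁ braid X Z ∘ br X Y Z.
Proof. by rewrite braid_tensr brE ?compA. Qed.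

Lemma braid_hexl X Y Z :
  braid (X ⊗ Y) Z = br X Z Y ∘ X ◁ braid Y Z ∘ assocV X Y Z.
Proof. by rewrite braid_tensl brE ?compA. Qed.

Lemma yang_baxter X Y Z :
  br Y Z X ∘ Y ◁ braid X Z ∘ br X Y Z =
  Z ◁ braid X Y ∘ br X Z Y ∘ X ◁ braid Y Z.
Proof.
have := braid_nat (braid X Y) (idm Z); rewrite !braid_hexl => E.
have := congr1 (fun f => f ∘ assoc X Y Z) E.
rewrite !compA -(compA _ (assocV X Y Z) (assoc X Y Z)) assocK compm1.
by rewrite -2!(compA (_ ∘ Y ◁ braid X Z)) -brE.
Qed.

Lemma ptrace_natl X A B B' (k : hom B B') (h : hom (X ⊗ A) (X ⊗ B)) :
  ptrace (X ◁ k ∘ h) = k ∘ ptrace h.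
Proof. by rewrite /ptrace ltensM !compA EV_nat. Qed.

Lemma ptrace_natr X A A' B (h : hom (X ⊗ A) (X ⊗ B)) (k : hom A' A) :
  ptrace (h ∘ X ◁ k) = ptrace h ∘ k.
Proof. by rewrite /ptrace ltensM -!compA CO'_nat !compA. Qed.

Lemma trace_mor_monodromy_braid X Y :
  trace_mor (monodromy (X ⊗ X) Y ∘ braid X X ▷ Y) =
  trace_mor (monodromy X Y ∘ twist X ▷ Y ∘ monodromy X Y).
Proof.
rewrite -[monodromy _ _ ∘ _ in LHS]compm1 -(assocVK X X Y) !compA tr1C.
rewrite -trace_mor_prod !compA; congr trace_mor.
rewrite {1}/monodromy braid_hexr braid_hexl !compA assocK comp1m.
rewrite -(compA _ (assocV X X Y)) -(compA _ (_ ∘ _) (assoc _ _ _)) -brE.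
(* Two Yang-Baxter moves place the crossing of the two copies of X between factors acting on the
   last two strands only. These factors leave the partial trace, and a kink remains. *)
rewrite (comp_eq3 (yang_baxter _ _ _)) !compA (comp_eq3 (yang_baxter _ _ _)) !compA.
rewrite -ltensM -(compA _ (X ◁ _)) -ltensM -(compA _ (br _ _ _)) ptrace_natl.
by rewrite ptrace_natr kink !compA.
Qed.

Lemma twist_prod X Y : twist (X ⊗ Y) = monodromy X Y ∘ (twist X ⊠ twist Y).
Proof. exact: twist_tens. Qed.

Lemma rotation_cup X (f : hom 𝟙 (X ⊗ X)) :
  FS_rotation f = (X ◁ twist X) ∘ braid X X ∘ f.
Proof.
have cup1 X' Y (k : hom 𝟙 (X' ⊗ Y)) : X' ◁ runit Y ∘ cup k 𝟙 = k.
  rewrite cupE splitE -[RHS]compm1.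
  rewrite (_ : X' ◁ runit Y = runit (X' ⊗ Y) ∘ assoc _ _ _); last first.
    by eqm_chain; eqm_cong.
  rewrite !compA -(compA _ (assoc _ _ _)) assocVK compm1 tensm1 -compA.
  by congr (_ ∘ _); rewrite eqmM eqm_id.
have := congr1 (fun g => X ◁ runit X ∘ g) (FS_family f 𝟙).
rewrite /= -(compA _ _ (cup f 𝟙)) br_cup !compA -(ltensM X (runit X)).
rewrite tensm1 ltensM -(compA _ _ (cup _ 𝟙)) cup1 => E.
rewrite -compA -E.
rewrite -EV_nat -(compA (EV X _)) -ltensM -cup_nat ltensM !compA.
rewrite -(compA _ _ (CO' X 𝟙)) /CO' cup1 /FS_rotation /EV capE mergeE cupE splitE.
by rewrite !compA.
Qed.

End Monodromy.

(** * Duals and dimensions *)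

Section Duals.
Variables (R : realType) (C : ribbonCategory R).
Implicit Types A B X Y Z W G : C.

Lemma cup_unit X Y (k : hom 𝟙 (X ⊗ Y)) : X ◁ runit Y ∘ cup k 𝟙 = k.
Proof.
rewrite cupE splitE -[RHS]compm1.
rewrite (_ : X ◁ runit Y = runit (X ⊗ Y) ∘ assoc _ _ _); last first.
  by eqm_chain; eqm_cong.
rewrite !compA -(compA _ (assoc _ _ _)) assocVK compm1 tensm1 -compA.
by congr (_ ∘ _); rewrite eqmM eqm_id.
Qed.

Lemma mate_cup X (k : hom 𝟙 (X ⊗ dual X)) W :
  (runit X ∘ X ◁ ev X ∘ assocV X (dual X) X ∘ k ▷ X ∘ lunitV X) ▷ W =
  X ◁ EV X W ∘ cup k (X ⊗ W).
Proof.
rewrite /EV capE cupE mergeE splitE !rtensM !ltensM lrtens rrtens.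
by eqm_chain; eqm_cong.
Qed.

(** The dual leg of [k] is bent back with [ev]. For simple X this makes [coev X] span its space, by
    Schur. *)
Lemma cup_coev X (k : hom 𝟙 (X ⊗ dual X)) :
  exists f : hom X X, k = f ▷ dual X ∘ coev X.
Proof.
exists (runit X ∘ X ◁ ev X ∘ assocV X (dual X) X ∘ k ▷ X ∘ lunitV X).
rewrite -[LHS]cup_unit -[RHS]cup_unit -tw_cup; congr (_ ∘ _).
rewrite mate_cup -(compA (X ◁ _)) cup_nat compA -ltensM.
by rewrite -/(CO X 𝟙) zigzagF_dual tensm_id comp1m.
Qed.

Lemma rtens_inj X Y (f g : hom X Y) : f ▷ 𝟙 = g ▷ 𝟙 -> f = g.
Proof.
move=> E; rewrite -[f]comp1m -[g]comp1m -runitVK -!compA.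
by rewrite !runitV_nat E.
Qed.

Lemma dual_mor_coev X (g : hom (dual X) (dual X)) (z : R[i]) :
  X ◁ g ∘ coev X = z *: coev X -> g = z *: idm _.
Proof.
move=> E; apply: rtens_inj.
have cZ : X ◁ (g ▷ 𝟙) ∘ CO X 𝟙 = z *: CO X 𝟙.
  rewrite /CO !cupE !splitE !compA -assocV_nat -(compA (assocV _ _ _)) -rtensM E.
  by rewrite tensZl compZr compZl.
rewrite -[LHS]compm1 -zigzagF_dual compA -EV_nat -compA -ltensM cZ.
by rewrite tensZr compZr zigzagF_dual tensZl tensm_id.
Qed.

(** Closing the strand X joins the cap and the cup into two zigzags. Taking full traces then gives
    [qdim_dual]. *)
Lemma ptrace_coev_ev' X : ptrace (coev X ∘ ev' X) = idm (dual X).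
Proof.
apply: rtens_inj; rewrite -ptrace_act2 act2_split_merge.
have -> : split (coev X) 𝟙 ∘ merge (ev' X) 𝟙 = CO X 𝟙 ∘ EV' X 𝟙.
  rewrite /CO /EV' cupE capE !compA -(compA _ (lunitV _)) lunitK compm1.
  by [].
rewrite /ptrace ltensM !compA zigzagF_dual comp1m zigzag'_dual.
by rewrite tensm_id.
Qed.

End Duals.

Section Premodular.
Variables (R : realType) (C : premodularCategory R).
Implicit Types A B X Y Z W G : C.

Let Cab := pm_abelian C.

Lemma trace_morE X (f : hom X X) : trace_mor f = spherical_trace f *: idm (𝟙 : C).
Proof. by rewrite spherical_traceE; exact: schurE (pm_unit_simple C). Qed.

Lemma trC X Y (f : hom X Y) (g : hom Y X) :
  spherical_trace (f ∘ g) = spherical_trace (g ∘ f).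
Proof. by rewrite !spherical_traceE tr1C. Qed.

Lemma tr_ptrace X Y (f : hom (X ⊗ Y) (X ⊗ Y)) :
  spherical_trace (ptrace f) = spherical_trace f.
Proof. by rewrite !spherical_traceE trace_mor_prod. Qed.

Lemma trP X (a : R[i]) (f g : hom X X) :
  spherical_trace (a *: f + g) = a * spherical_trace f + spherical_trace g.
Proof.
by rewrite !spherical_traceE /trace_mor tensm_linearr comp_linearr comp_linearl /scalar_of linearP.
Qed.

Lemma tr0 X : spherical_trace (0 : hom X X) = 0.
Proof. by have := trP (-1) (0 : hom X X) 0; rewrite scaler0 addr0 mulN1r addNr. Qed.

Lemma trZ X (a : R[i]) (f : hom X X) :
  spherical_trace (a *: f) = a * spherical_trace f.
Proof. by rewrite -[a *: f]addr0 trP tr0 addr0. Qed.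

Lemma tr_sum X (I : finType) (P : pred I) (f : I -> hom X X) :
  spherical_trace (\sum_(i | P i) f i) = \sum_(i | P i) spherical_trace (f i).
Proof.
apply: (big_morph _ _ (tr0 X)) => f' g.
by rewrite -[f']scale1r trP mul1r scale1r.
Qed.

Lemma ptrace_scalar X (f : hom X X) Z :
  ptrace (f ▷ Z) = spherical_trace f *: idm Z.
Proof.
by rewrite ptrace_rtens trace_morE tensZl tensm_id compZr compm1 compZl lunitVK.
Qed.

Lemma tr_rtens X (f : hom X X) Y :
  spherical_trace (f ▷ Y) = spherical_trace f * qdim Y.
Proof. by rewrite -tr_ptrace ptrace_scalar trZ. Qed.

Lemma qdimM X Y : qdim (X ⊗ Y) = qdim X * qdim Y.
Proof. by rewrite -tr_rtens /qdim tensm_id. Qed.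

Lemma qdim_iso X Y : isomorphic X Y -> qdim X = qdim Y.
Proof. by move=> [f [g [gK Kg]]]; rewrite /qdim -gK -Kg trC. Qed.

Lemma coev_scalar X (k : hom 𝟙 (X ⊗ dual X)) : is_simple X ->
  exists z : R[i], k = z *: coev X.
Proof.
move=> sX; have [f ->] := cup_coev k.
have [z ->] := schur Cab f sX; exists z.
by rewrite tensZl tensm_id compZl comp1m.
Qed.

End Premodular.

Section SimpleIso.
Variables (R : realType) (C : linearCategory R).
Implicit Types A B X Y Z W G : C.

Lemma isomorphic_sym X Y : isomorphic X Y -> isomorphic Y X.
Proof. by case=> f [g [gK Kg]]; exists g, f. Qed.

Lemma isomorphic_trans X Y Z : isomorphic X Y -> isomorphic Y Z -> isomorphic X Z.
Proof.
move=> [f [f' [fK Kf]]] [g [g' [gK Kg]]]; exists (g ∘ f), (f' ∘ g'); split.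
  by rewrite !compA -(compA f') gK compm1.
by rewrite !compA -(compA g) Kf compm1.
Qed.

Lemma simple_iso X Y : isomorphic X Y -> is_simple X -> is_simple Y.
Proof.
move=> [f [g [gK Kg]]] [nz sX]; split=> [Y0|W k kmono].
  by apply: nz; rewrite -gK -[g]compm1 Y0 comp0r comp0l.
have [|g0|[h [hK Kh]]] := sX W (g ∘ k).
- move=> Z h h' E; apply: kmono; rewrite -[k]comp1m -Kg.
  by rewrite -(compA f g k) -!(compA f) E.
- by left; rewrite -[k]comp1m -Kg -compA g0 comp0r.
right; exists (h ∘ g); split; first by rewrite -compA.
by rewrite -[LHS]comp1m -Kg !compA -(compA f g k) -(compA f) Kh compm1.
Qed.

End SimpleIso.

Section Simples.
Variables (R : realType) (C : premodularCategory R).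
Implicit Types A B X Y Z W G : C.

Let Cab := pm_abelian C.
Let Css := @pm_semisimple R C.

(** A nonzero summand gives a nonzero idempotent; being a scalar it is the identity, so X is
    isomorphic to that simple summand. *)
Lemma simple_of_end X : idm X <> 0 ->
  (forall f : hom X X, exists z : R[i], f = z *: idm X) -> is_simple X.
Proof.
move=> nz sc; have [n [F [sF [inj [proj [pi _ ip]]]]]] := Css X.
have [k kn] : exists k, inj k ∘ proj k <> 0.
  apply: contrapT => /forallNP n0; apply: nz; rewrite -ip big1// => k _.
  by have /contrapT := n0 k.
have [z E] := sc (inj k ∘ proj k).
have z0 : z != 0 by apply/eqP => z0; apply: kn; rewrite E z0 scale0r.
have zz : z *: idm X = idm X.
  apply: (scalerI z0); rewrite -E -[X in _ *: X]comp1m -compZl -E !compA.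
  by rewrite -(compA (inj k)) pi compm1.
by apply: simple_iso (sF k); exists (inj k), (proj k); rewrite pi E.
Qed.

Lemma dual_end X (g : hom (dual X) (dual X)) : is_simple X ->
  exists z : R[i], g = z *: idm _.
Proof.
move=> sX; have [z E] := coev_scalar (X ◁ g ∘ coev X) sX.
by exists z; exact: dual_mor_coev.
Qed.

Lemma coev_neq0 X : idm X <> 0 -> coev X <> 0.
Proof.
move=> nz c0; apply: nz; rewrite -zigzag c0 tens0l.
by rewrite comp0r comp0l.
Qed.

Lemma dual_neq0 X : idm X <> 0 -> idm (dual X) <> 0.
Proof.
move=> nz d0; apply: (coev_neq0 nz).
by rewrite -[coev X]comp1m -tensm_id d0 tens0r comp0l.
Qed.

Lemma twistE X : is_simple X -> twist X = twist_scalar X *: idm X.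
Proof. exact: schurE. Qed.

Lemma twist_scalar_neq0 X : is_simple X -> twist_scalar X != 0.
Proof.
move=> sX; apply/eqP => t0; have [g [gK _]] := twist_iso X.
by case: (sX) => nz _; apply: nz; rewrite -gK (twistE sX) t0 scale0r comp0r.
Qed.

Lemma twist_scalar_iso X Y : is_simple X -> isomorphic X Y ->
  twist_scalar X = twist_scalar Y.
Proof.
move=> sX XY; have sY := simple_iso XY sX; case: XY => f [g [gK Kg]].
have := twist_nat f; rewrite !twistE// compZl compZr comp1m compm1.
move=> /(congr1 (fun h => g ∘ h)); rewrite !compZr gK => /eqP.
rewrite -subr_eq0 -scalerBl scaler_eq0 subr_eq0 => /orP[/eqP ->//|/eqP].
by case: sX.
Qed.

Lemma twist_scalar_dual X : is_simple X ->
  twist_scalar (dual X) = twist_scalar X.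
Proof.
move=> sX; have E := twist_dual X.
rewrite {1}twistE// tensZl tensm_id compZl comp1m in E.
rewrite /twist_scalar (dual_mor_coev (esym E)) scalar_ofZ//.
by apply: dual_neq0; case: sX.
Qed.

(** If the dimension vanished, [ev' X] would kill [coev X] and hence every morphism from 𝟙. By
    semisimplicity it would be 0, against [zigzag']. *)
Lemma qdim_neq0 X : is_simple X -> qdim X != 0.
Proof.
move=> sX; apply/eqP => d0.
have nzX : idm X <> 0 by case: sX.
have [n [S HS]] := pm_finite C.
have e0 : ev' X = 0.
  apply: (mor_to_simple_eq0 Cab Css HS (pm_unit_simple C)) => k.
  have [z ->] := coev_scalar k sX; rewrite compZr -[ev' X]compm1 -tensm_id.
  by rewrite trace_mor_spherical trace_morE -/(qdim X) d0 scale0r scaler0.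
apply: nzX; apply: rtens_inj; rewrite tensm_id tens0l -zigzag' /EV' e0 capE mergeE.
by rewrite tens0l comp0l comp0r comp0l.
Qed.

Lemma qdim_unit : qdim (𝟙 : C) = 1.
Proof.
have := qdimM (𝟙 : C) 𝟙.
have -> : qdim (𝟙 ⊗ 𝟙 : C) = qdim (𝟙 : C).
  by apply: qdim_iso; exists (lunit 𝟙); exact: eqm_iso.
rewrite -[X in X = _]mulr1 => /(mulfI (qdim_neq0 (pm_unit_simple C))) E.
by rewrite -E.
Qed.

Lemma qdim_dual X : qdim (dual X) = qdim X.
Proof.
rewrite {1}/qdim -ptrace_coev_ev' tr_ptrace trC -[ev' X]compm1 -tensm_id.
by rewrite trace_mor_spherical trace_morE trZ -/(qdim 𝟙) qdim_unit mulr1.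
Qed.

Lemma dual_simple X : is_simple X -> is_simple (dual X).
Proof.
move=> sX; apply: simple_of_end => [|f]; first by apply: dual_neq0; case: sX.
exact: dual_end.
Qed.

Lemma dim_hom_tens_dual X Y Z :
  \dim {: hom (dual X ⊗ Y) Z} = \dim {: hom Y (X ⊗ Z)}.
Proof.
pose f (h : hom (dual X ⊗ Y) Z) : hom Y (X ⊗ Z) := X ◁ h ∘ CO X Y.
pose g (h : hom Y (X ⊗ Z)) : hom (dual X ⊗ Y) Z := EV X Z ∘ dual X ◁ h.
apply: (@dim_bij _ _ _ f g) => [a x y|h|h].
- by rewrite /f tensm_linearr comp_linearl.
- by rewrite /f /g ltensM compA EV_nat -compA zigzagF_dual compm1.
by rewrite /f /g ltensM -compA -CO_nat compA zigzagF comp1m.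
Qed.

Lemma dim_hom_isol X Y Z : isomorphic X Y -> \dim {: hom X Z} = \dim {: hom Y Z}.
Proof.
move=> [f [g [gK Kg]]].
apply: (@dim_bij _ _ _ (fun h : hom X Z => h ∘ g) (fun h : hom Y Z => h ∘ f)).
- by move=> a x y; rewrite comp_linearl.
- by move=> h; rewrite -compA gK compm1.
by move=> h; rewrite -compA Kg compm1.
Qed.

Lemma dim_hom_isor X Y Z : isomorphic X Y -> \dim {: hom Z X} = \dim {: hom Z Y}.
Proof.
move=> [f [g [gK Kg]]].
apply: (@dim_bij _ _ _ (fun h : hom Z X => f ∘ h) (fun h : hom Z Y => g ∘ h)).
- by move=> a x y; rewrite comp_linearr.
- by move=> h; rewrite compA gK comp1m.
by move=> h; rewrite compA Kg comp1m.
Qed.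

Lemma braid_isomorphic X Y : isomorphic (X ⊗ Y) (Y ⊗ X).
Proof. by exists (braid X Y); exact: braid_iso. Qed.

Lemma tens_isomorphic X Y Z : isomorphic X Y -> isomorphic (X ⊗ Z) (Y ⊗ Z).
Proof.
by case=> f fi; exists (f ▷ Z); exact: rtens_iso.
Qed.

(** * Traces computed over the simple objects *)

Section System.
Variables (m : nat) (S : 'I_m -> C).
Hypothesis HS : represents_simples S.

Let sS := simpleS HS.

Lemma trace_decomposition Z (f : hom Z Z) :
  spherical_trace f =
  \sum_k qdim (S k) * op_trace (fun g : hom (S k) Z => f ∘ g).
Proof.
rewrite -[f in LHS]compm1 -(resolution Cab Css HS Z) comp_sumr tr_sum.
apply: eq_bigr => k _; rewrite comp_sumr tr_sum /op_trace mulr_sumr.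
apply: eq_bigr => i _; rewrite compA trC hom_dual_basisE trZ mulrC; congr (_ * _).
Qed.

Lemma op_trace_scale k Z (F : hom (S k) Z -> hom (S k) Z) (z : R[i]) :
  (forall g, F g = z *: g) -> op_trace F = z * (\dim {: hom (S k) Z})%:R.
Proof.
move=> FE; rewrite /op_trace (eq_bigr (fun=> z)).
  by rewrite sumr_const card_ord mulr_natr.
move=> i _; rewrite FE linearZ /= coord_free ?(basis_free (vbasisP _))//.
by rewrite eqxx mulr1.
Qed.

Lemma qdim_sum Z : \sum_k (\dim {: hom Z (S k)})%:R * qdim (S k) = qdim Z.
Proof.
rewrite /qdim [RHS]trace_decomposition; apply: eq_bigr => k _.
rewrite (@op_trace_scale _ _ _ 1) => [|g]; last by rewrite comp1m scale1r.
by rewrite mul1r mulrC -(dim_hom_sym Cab Css HS).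
Qed.

Lemma tr_twist2 Z :
  spherical_trace (twist Z ∘ twist Z) =
  \sum_k (\dim {: hom Z (S k)})%:R * qdim (S k) * twist_scalar (S k) ^+ 2.
Proof.
rewrite trace_decomposition; apply: eq_bigr => k _.
rewrite (@op_trace_scale _ _ _ (twist_scalar (S k) ^+ 2)) => [|g].
  by rewrite (dim_hom_sym Cab Css HS) mulrA mulrC mulrA.
rewrite -compA twist_nat [twist Z ∘ g]twist_nat (twistE (sS k)).
by rewrite !compZr !compm1 scalerA.
Qed.

Definition smatrix k b := spherical_trace (monodromy (S k) (S b)).

(** The resolution of [idm Z] is inserted, and naturality carries the monodromy along each vertex
    down to a simple strand. *)
Lemma tr_monodromy_rtens Z (f : hom Z Z) b :
  spherical_trace (monodromy Z (S b) ∘ f ▷ S b) =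
  \sum_k op_trace (fun g : hom (S k) Z => f ∘ g) * smatrix k b.
Proof.
rewrite -[f in LHS]compm1 -(resolution Cab Css HS Z) comp_sumr.
have tsum (I : finType) (F : I -> hom Z Z) :
    (\sum_i F i) ▷ S b = \sum_i F i ▷ S b.
  exact: (big_morph (fun g => g ▷ S b) (fun _ _ => tensDl _ _ _) (tens0l _ _ _)).
rewrite tsum comp_sumr tr_sum; apply: eq_bigr => k _.
rewrite comp_sumr tsum comp_sumr tr_sum /op_trace mulr_suml.
apply: eq_bigr => i _; rewrite compA rtensM compA trC compA.
rewrite -monodromy_nat -compA -rtensM hom_dual_basisE tensZl tensm_id compZr compm1.
by rewrite trZ.
Qed.

Lemma tr_monodromy_sqr a b :
  spherical_trace (monodromy (S a) (S b) ∘ twist (S a) ▷ S b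
                     ∘ monodromy (S a) (S b)) =
  (twist_scalar (S a) * twist_scalar (S b) ^+ 2)^-1 *
  \sum_k (\dim {: hom (S a ⊗ S b) (S k)})%:R * qdim (S k) *
         twist_scalar (S k) ^+ 2.
Proof.
have ta := twist_scalar_neq0 (sS a); have tb := twist_scalar_neq0 (sS b).
(* Balancing turns the monodromy into a multiple of the twist of the product, whose square
   [tr_twist2] evaluates channel by channel. *)
have ME : monodromy (S a) (S b) =
    (twist_scalar (S a) * twist_scalar (S b))^-1 *: twist (S a ⊗ S b).
  rewrite twist_prod !twistE// tensZl tensZr tensm_id !compZr compm1 !scalerA.
  by rewrite mulVf ?scale1r// mulf_neq0.
rewrite -tr_twist2 ME (twistE (sS a)) tensZl tensm_id !(compZr, compZl) compm1 !trZ.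
by rewrite !mulrA; congr (_ * _); field; rewrite ta tb.
Qed.

(** Two evaluations of one trace, that of the monodromy of [S a ⊗ S a] with [S b] after a crossing:
    by decomposing the pair, and by Yang-Baxter moves and the kink. *)
Lemma sum_op_trace_braid a b :
  twist_scalar (S a) *
    \sum_k op_trace (@R_op R C (S k) (S a)) * smatrix k b =
  \sum_k (\dim {: hom (S a ⊗ S b) (S k)})%:R * qdim (S k) *
         (twist_scalar (S k) / twist_scalar (S b)) ^+ 2.
Proof.
have ta := twist_scalar_neq0 (sS a); have tb := twist_scalar_neq0 (sS b).
rewrite -(tr_monodromy_rtens (braid (S a) (S a))).
rewrite [spherical_trace _]spherical_traceE trace_mor_monodromy_braid -spherical_traceE.
rewrite tr_monodromy_sqr mulrA mulr_sumr; apply: eq_bigr => k _.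
by field; rewrite ta tb.
Qed.

End System.

End Simples.

(** * The handle slide *)

Section HandleSlide.
Variables (R : realType) (C : premodularCategory R).
Implicit Types A B X Y Z W G : C.

Let Cab := pm_abelian C.
Let Css := @pm_semisimple R C.

Variables (m : nat) (S : 'I_m -> C).
Hypothesis HS : represents_simples S.

Let sS := simpleS HS.

(* The fusion matrices of a and of its dual are transposes of each other, and
   both have the vector of dimensions as eigenvector, with eigenvalue qdim a. *)
Lemma qdim_real a : Num.conj (qdim (S a)) = qdim (S a).
Proof.
(* [q] is the squared hermitian norm of the vector of dimensions. The dimension of [S a] and its
   conjugate are shown to have the same product with this positive number. *)
pose d k := qdim (S k); pose q := \sum_k d k * Num.conj (d k).
have q0 : q != 0.
  apply: lt0r_neq0; rewrite /q (bigD1 a)//= ltr_pwDl ?mul_conjC_gt0 ?qdim_neq0//.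
  by apply: sumr_ge0 => k _; exact: mul_conjC_ge0.
apply/esym/(mulIf q0); rewrite {1}/q mulr_sumr.
transitivity (\sum_k \sum_l
    (\dim {: hom (S a ⊗ S k) (S l)})%:R * d l * Num.conj (d k)).
  by apply: eq_bigr => k _; rewrite mulrA -qdimM -(qdim_sum HS) mulr_suml.
rewrite exchange_big mulr_sumr; apply: eq_bigr => l _ /=.
rewrite mulrCA -rmorphM -(qdim_dual (S a)) -qdimM -(qdim_sum HS) rmorph_sum.
rewrite mulr_sumr; apply: eq_bigr => k _.
rewrite rmorphM rmorph_nat mulrA; congr (_ * _); rewrite mulrC; congr (_ * _%:R).
by rewrite dim_hom_tens_dual (dim_hom_sym Cab Css HS).
Qed.

(** Since dimensions are real, the squares are squared moduli; the index [a] provides a strictly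
    positive term. *)
Lemma global_dim_neq0 (a : 'I_m) : \sum_k qdim (S k) ^+ 2 != 0.
Proof.
apply: lt0r_neq0; rewrite (bigD1 a)//= ltr_pwDl//.
  by rewrite expr2 -{2}qdim_real mul_conjC_gt0 qdim_neq0.
by apply: sumr_ge0 => k _; rewrite expr2 -{2}qdim_real mul_conjC_ge0.
Qed.

Section Mates.
Variables (b c : 'I_m).

Let I e := 'I_(\dim {: hom (S c) (S b ⊗ S e)}).

Definition mate_in e (i : I e) : hom (S e) (dual (S b) ⊗ S c) :=
  dual (S b) ◁ hom_dual_basis Cab Css HS i ∘ CO' (S b) (S e).

Definition mate_out e (i : I e) : hom (dual (S b) ⊗ S c) (S e) :=
  EV (S b) (S e) ∘ dual (S b) ◁ hom_basis i.

(** The composite is a partial trace over [S b], a scalar by Schur; its full trace, computed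
    cyclically in [S c], fixes the scalar. *)
Lemma mate_out_in e (i j : I e) :
  mate_out i ∘ mate_in j = ((j == i)%:R * qdim (S c) / qdim (S e)) *: idm (S e).
Proof.
have E : mate_out i ∘ mate_in j = ptrace (hom_basis i ∘ hom_dual_basis Cab Css HS j).
  by rewrite /mate_out /mate_in /ptrace ltensM !compA.
have [x xE] := schur Cab (mate_out i ∘ mate_in j) (sS e).
have d0 := qdim_neq0 (sS e).
rewrite xE; congr (_ *: _); apply: (mulIf d0); rewrite mulfVK//.
rewrite -[LHS]trZ -xE E tr_ptrace trC hom_dual_basis_hom_basis trZ; by [].
Qed.

Lemma mate_inE e (g : hom (S e) (dual (S b) ⊗ S c)) :
  exists l : I e -> R[i], g = \sum_i l i *: mate_in i.
Proof.
pose h := EV' (S b) (S c) ∘ S b ◁ g.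
exists (fun i => scalar_of (h ∘ hom_basis i)).
have gE : g = dual (S b) ◁ h ∘ CO' (S b) (S e).
  by rewrite /h ltensM -compA -CO'_nat compA zigzag'_dual comp1m.
rewrite gE [h in LHS](hom_dual_basisP Cab Css HS) tens_sumr comp_suml.
by apply: eq_bigr => i _; rewrite tensZr compZl.
Qed.

Lemma mate_resolution :
  \sum_e \sum_(i : I e) (qdim (S e) / qdim (S c)) *: (mate_in i ∘ mate_out i) =
  idm (dual (S b) ⊗ S c).
Proof.
have dc := qdim_neq0 (sS c).
apply: (simple_sep Css HS) => k g; rewrite comp1m.
have [l ->] := mate_inE g; rewrite comp_sumr; apply: eq_bigr => j _.
rewrite compZr; congr (_ *: _); rewrite comp_suml (bigD1 k)//=.
rewrite [X in _ + X]big1 => [|e ek]; last first.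
  rewrite comp_suml big1// => i _; rewrite compZl -compA.
  by rewrite (schur_neq Cab HS (mate_out i ∘ _)) ?comp0r ?scaler0// eq_sym.
rewrite addr0 comp_suml (bigD1 j)//= [X in _ + X]big1 => [|i ij].
  rewrite addr0 compZl -compA mate_out_in eqxx compZr compm1 scalerA.
  have dk := qdim_neq0 (sS k).
  by rewrite mulr1n mul1r mulrA divfK ?divff ?scale1r.
by rewrite compZl -compA mate_out_in eq_sym (negPf ij) !mul0r scale0r comp0r scaler0.
Qed.

Lemma basE_mate e (i : I e) :
  hom_basis i = S b ◁ mate_out i ∘ CO (S b) (S c).
Proof. by rewrite /mate_out ltensM -compA -CO_nat compA zigzagF comp1m. Qed.

Lemma dbasE_mate e (i : I e) :
  hom_dual_basis Cab Css HS i = EV' (S b) (S c) ∘ S b ◁ mate_in i.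
Proof. by rewrite /mate_in ltensM compA EV'_nat -compA zigzag' compm1. Qed.

End Mates.

Definition right_ptrace X Y (G : hom (Y ⊗ X) (Y ⊗ X)) : hom Y Y :=
  runit Y ∘ Y ◁ ev' X ∘ assocV Y X (dual X) ∘ G ▷ dual X
    ∘ assoc Y X (dual X) ∘ Y ◁ coev X ∘ runitV Y.

Lemma right_ptraceE X Y (G : hom (Y ⊗ X) (Y ⊗ X)) W :
  Y ◁ EV' X W ∘ act2 G (dual X ⊗ W) ∘ Y ◁ CO X W = right_ptrace G ▷ W.
Proof.
rewrite /right_ptrace /EV' /CO; move: (ev' X) (coev X) => e k.
rewrite capE cupE mergeE splitE act2E !rtensM !ltensM !lrtens rrtens.
eqm_chain.
by rewrite ?eqm_id ?comp1m ?compm1; eqm_cong.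
Qed.

(* Bending b turns the dual bases of hom c (b ⊗ e) and hom (b ⊗ e) c into those
   of hom e (b* ⊗ c) and hom (b* ⊗ c) e, rescaled by qdim c / qdim e. *)
Lemma handle_slide Y b c (G : hom (Y ⊗ S b) (Y ⊗ S b)) :
  \sum_e \sum_(i < \dim {: hom (S c) (S b ⊗ S e)})
    qdim (S e) *: (Y ◁ hom_dual_basis Cab Css HS i ∘ act2 G (S e) ∘ Y ◁ hom_basis i) =
  qdim (S c) *: (right_ptrace G ▷ S c).
Proof.
(* [Phi h] is the right closure of [G] with [h] inserted on the returning strand and [S c]. It is
   linear in [h], so the resolution by mates can be expanded inside it. *)
pose Phi (h : hom (dual (S b) ⊗ S c) (dual (S b) ⊗ S c)) :=
  Y ◁ EV' (S b) (S c) ∘ act2 G _ ∘ Y ◁ (S b ◁ h) ∘ Y ◁ CO (S b) (S c).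
have PhiD : {morph Phi : h h' / h + h'}.
  by move=> h h'; rewrite /Phi !tensDr compDr compDl.
have PhiZ a h : Phi (a *: h) = a *: Phi h.
  by rewrite /Phi !tensZr compZr compZl.
have Phi0 : Phi 0 = 0 by rewrite -(scale0r 0) PhiZ scale0r.
have dc := qdim_neq0 (sS c).
have <- : Phi (idm _) = right_ptrace G ▷ S c by rewrite /Phi !tensm_id compm1 right_ptraceE.
rewrite -(mate_resolution b c) (big_morph _ PhiD Phi0) scaler_sumr.
apply: eq_bigr => e _; rewrite (big_morph _ PhiD Phi0) scaler_sumr.
apply: eq_bigr => i _; rewrite PhiZ scalerA mulrCA divff// mulr1.
congr (_ *: _); rewrite dbasE_mate (basE_mate i).
move: (mate_in i) (mate_out i) => u v; rewrite /Phi !ltensM !compA.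
by rewrite (comp_eq2 (act2_nat G u)) ?compA.
Qed.

(** The strand summed with weights [qdim] swallows [S b]. The natural family [F] is what this strand
    does to Y; it is used below for the identity and for the monodromy. *)
Lemma handle_slide_trace Y b (G : hom (Y ⊗ S b) (Y ⊗ S b))
    (F : forall W, hom (Y ⊗ W) (Y ⊗ W)) (z : R[i]) :
  (forall W W' (f : hom W W'), F W' ∘ Y ◁ f = Y ◁ f ∘ F W) ->
  right_ptrace G = z *: idm Y ->
  \sum_e qdim (S e) * spherical_trace (F (S b ⊗ S e) ∘ act2 G (S e)) =
  z * \sum_c qdim (S c) * spherical_trace (F (S c)).
Proof.
move=> Fnat Gz.
transitivity (\sum_c \sum_e \sum_(i < \dim {: hom (S c) (S b ⊗ S e)})
    qdim (S e) * spherical_trace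
      (F (S c) ∘ (Y ◁ hom_dual_basis Cab Css HS i ∘ act2 G (S e) ∘ Y ◁ hom_basis i))).
  rewrite exchange_big; apply: eq_bigr => e _.
  rewrite -[in LHS](comp1m (act2 G (S e))) -tensm_id.
  rewrite -(resolution Cab Css HS (S b ⊗ S e)) tens_sumr comp_suml comp_sumr.
  rewrite tr_sum mulr_sumr; apply: eq_bigr => c _.
  rewrite tens_sumr comp_suml comp_sumr tr_sum mulr_sumr; apply: eq_bigr => i _.
  by rewrite ltensM !compA Fnat -!(compA (Y ◁ hom_basis i)) trC ?compA.
rewrite mulr_sumr; apply: eq_bigr => c _.
transitivity (spherical_trace (F (S c) ∘ (qdim (S c) *: (right_ptrace G ▷ S c)))).
  rewrite -handle_slide comp_sumr tr_sum; apply: eq_bigr => e _.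
  rewrite comp_sumr tr_sum; apply: eq_bigr => i _.
  by rewrite compZr trZ.
by rewrite Gz tensZl tensm_id !compZr compm1 !trZ mulrCA.
Qed.

Lemma monodromy_tensr Y b e :
  monodromy Y (b ⊗ e) = br b Y e ∘ b ◁ monodromy Y e ∘ br Y b e.
Proof.
rewrite /monodromy braid_hexr braid_hexl !compA -(compA _ (assocV _ _ _)) assocK.
by rewrite compm1 ltensM !compA.
Qed.

Lemma tr_act2 Y b e (G : hom (Y ⊗ b) (Y ⊗ b)) :
  spherical_trace (act2 G e) = spherical_trace G * qdim e.
Proof.
by rewrite act2E -compA trC -compA assocVK compm1 tr_rtens.
Qed.

Lemma trace_nondegenerate Z (h : hom Z Z) :
  (forall f : hom Z Z, spherical_trace (f ∘ h) = 0) -> h = 0.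
Proof.
move=> h0; apply: (simple_sep Css HS) => l g; rewrite comp0l.
rewrite [LHS]hom_basisE big1// => i _; have := h0 (g ∘ hom_dual_basis Cab Css HS i).
rewrite -compA trC -compA hom_dual_basisE trZ => /eqP.
by rewrite mulf_eq0 (negPf (qdim_neq0 (sS l))) orbF => /eqP ->; rewrite scale0r.
Qed.

(** When the sum is nonzero, composing with the monodromy of [S k] and [S b] preserves the trace of
    every endomorphism [G]. The trace form being nondegenerate, this monodromy is the identity. *)
Lemma smatrix_transparent k :
  \sum_e qdim (S e) * smatrix S k e != 0 -> is_transparent (S k).
Proof.
move=> w0; have dk := qdim_neq0 (sS k).
have D0 := global_dim_neq0 k.
have trM b (G : hom (S k ⊗ S b) (S k ⊗ S b)) :
    spherical_trace (G ∘ monodromy (S k) (S b)) = spherical_trace G.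
  have [z Gz] := schur Cab (right_ptrace G) (sS k).
  have zE : spherical_trace G = z * qdim (S k).
    (* The slide with the identity family determines [z] from the trace of [G], after division by
       the nonzero global dimension. *)
    have Fnat W W' (f : hom W W') :
      idm (S k ⊗ W') ∘ S k ◁ f = S k ◁ f ∘ idm (S k ⊗ W).
      by rewrite comp1m compm1.
    have := handle_slide_trace Fnat Gz.
    under eq_bigr => e _ do rewrite comp1m tr_act2 mulrCA -expr2.
    under [X in _ = z * X]eq_bigr => e _ do rewrite -/(qdim _) qdimM mulrCA -expr2.
    by rewrite -!mulr_sumr mulrA => /(mulIf D0).
  (* [G'] is [G] with its strands exchanged; the scalar [x] of its partial trace over [S b] records
     the trace of [G] with the monodromy. *)
  pose G' := braid (S k) (S b) ∘ G ∘ braid (S b) (S k).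
  have [x G'x] := schur Cab (ptrace G') (sS k).
  have xE : spherical_trace (G ∘ monodromy (S k) (S b)) = x * qdim (S k).
    by rewrite -[RHS]trZ -G'x tr_ptrace /G' -compA [RHS]trC /monodromy compA.
  rewrite xE zE; congr (_ * _).
  (* The slide with the monodromy family gives [x] times the sum on one side and [z] times the same
     nonzero sum on the other. *)
  have Fnat W W' (f : hom W W') :
    monodromy (S k) W' ∘ S k ◁ f = S k ◁ f ∘ monodromy (S k) W.
    exact: monodromy_nat.
  have := handle_slide_trace Fnat Gz; rewrite -/(smatrix S k _) => E.
  apply: (mulIf w0); rewrite -E mulr_sumr; apply: eq_bigr => e _.
  rewrite mulrCA; congr (_ * _).
  rewrite monodromy_tensr -2!compA trC -!compA (compA (br _ _ _)).
  rewrite -!act2_br -!act2M -/G' -tr_ptrace ptrace_natl ptrace_act2 G'x tensZl tensm_id.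
  by rewrite compZr compm1 trZ.
have Mid b : monodromy (S k) (S b) = idm _.
  apply/eqP; rewrite -subr_eq0; apply/eqP/trace_nondegenerate => f.
  by rewrite compBr compm1 -scaleN1r addrC trP trM mulN1r addNr.
move=> Y; rewrite -/(monodromy (S k) Y) -[LHS]compm1 -tensm_id.
rewrite -(resolution Cab Css HS Y) !tens_sumr comp_sumr; apply: eq_bigr => l _.
rewrite !tens_sumr comp_sumr; apply: eq_bigr => i _.
by rewrite ltensM compA monodromy_nat -(compA _ (monodromy _ _)) Mid comp1m.
Qed.

Lemma sum_smatrix k :
  \sum_e qdim (S e) * smatrix S k e =
  if `[< is_transparent (S k) >] then qdim (S k) * \sum_e qdim (S e) ^+ 2 else 0.
Proof.
case: asboolP => [kt|knt]; last first.
  by apply/eqP; apply: contraT => /smatrix_transparent.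
rewrite mulr_sumr; apply: eq_bigr => e _.
rewrite /smatrix (_ : monodromy _ _ = idm _); last exact: kt.
by rewrite -/(qdim _) qdimM mulrCA -expr2.
Qed.

(** Duality reindexes the sum over simples. If distinct simples had isomorphic duals, Frobenius
    reciprocity would force [ev (S k)] to vanish, against the zigzag. *)
Lemma dual_perm : exists s : 'I_m -> 'I_m, injective s /\
  forall k, isomorphic (dual (S k)) (S (s k)).
Proof.
have /choice[s sP] k : exists l, isomorphic (dual (S k)) (S l).
  by case: HS => _ _; apply; exact: dual_simple.
exists s; split=> // k l E.
have [f [g [gK Kg]]] : isomorphic (dual (S k)) (dual (S l)).
  by apply: isomorphic_trans (sP k) _; apply: isomorphic_sym; rewrite E.
apply/eqP/negPn/negP => kl.
have := dim_hom_tens_dual (S l) (S k) 𝟙.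
rewrite (dim_hom_isor _ (X := S l ⊗ 𝟙) (Y := S l)); last by exists (runit (S l)); exact: eqm_iso.
have -> : \dim {: hom (S k) (S l)} = 0%N.
  apply/eqP; rewrite dimv_eq0 -subv0; apply/subvP => h _.
  by rewrite (schur_neq Cab HS h kl) mem0v.
move/eqP; rewrite dimv_eq0 => /eqP h0.
have := memvf (ev (S k) ∘ g ▷ S k).
rewrite h0 memv0 => /eqP e0.
have {}e0 : ev (S k) = 0.
  by rewrite -[LHS]compm1 -tensm_id -gK rtensM compA e0 comp0l.
apply: (nzS HS (k := k)); rewrite -zigzag e0 tens0r comp0r !comp0l.
by [].
Qed.

End HandleSlide.

(** * Assembling the formula *)

Section Final.
Variables (R : realType) (C : premodularCategory R).
Variables (m : nat) (S : 'I_m -> C).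
Hypothesis HS : represents_simples S.

Let Cab := pm_abelian C.
Let Css := @pm_semisimple R C.
Let sS := simpleS HS.

Lemma fusion_sum a :
  \sum_b \sum_c (fusion_coef (S b) (S c) (S a))%:R * qdim (S b) * qdim (S c)
      * (twist_scalar (S b) / twist_scalar (S c)) ^+ 2 =
  twist_scalar (S a) * ((\sum_k if `[< is_transparent (S k) >] then
      qdim (S k) * op_trace (@R_op R C (S k) (S a)) else 0)
    * \sum_e qdim (S e) ^+ 2).
Proof.
have [s [sI sP]] := dual_perm HS.
rewrite exchange_big (reindex_inj sI) /=.
transitivity (\sum_e qdim (S e) * (twist_scalar (S a) *
    \sum_k op_trace (@R_op R C (S k) (S a)) * smatrix S k e)).
  apply: eq_bigr => e _; rewrite (sum_op_trace_braid HS) mulr_sumr.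
  apply: eq_bigr => b _.
  (* With c the dual of e, twists and dimensions are unchanged. Braiding, Frobenius reciprocity and
     [dim_hom_sym] turn the fusion coefficient of b, c into a into that of a, e into b. *)
  rewrite -(twist_scalar_iso (dual_simple (sS e)) (sP e)) twist_scalar_dual//.
  rewrite -(qdim_iso (sP e)) qdim_dual /fusion_coef.
  rewrite (dim_hom_isol _ (braid_isomorphic _ _)).
  rewrite -(dim_hom_isol _ (tens_isomorphic _ (sP e))) dim_hom_tens_dual.
  rewrite -(dim_hom_sym Cab Css HS) (dim_hom_isol _ (braid_isomorphic _ _)).
  by ring.
rewrite (eq_bigr (fun e => twist_scalar (S a) * \sum_k qdim (S e) *
    (op_trace (@R_op R C (S k) (S a)) * smatrix S k e))); last first.
  by move=> e _; rewrite [LHS]mulrCA; congr (_ * _); exact: mulr_sumr.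
rewrite -mulr_sumr exchange_big mulr_suml /=; congr (_ * _).
apply: eq_bigr => k _ /=.
rewrite (eq_bigr (fun e => op_trace (@R_op R C (S k) (S a)) *
    (qdim (S e) * smatrix S k e))); last by move=> e _; rewrite mulrCA.
rewrite -mulr_sumr (sum_smatrix HS); case: asboolP => _; last by rewrite mulr0 mul0r.
by ring.
Qed.

Lemma unit_transparent : is_transparent (𝟙 : C).
Proof.
move=> Y; rewrite braid_unitl braid_unitr !compA -(compA (lunitV Y)) runitVK.
by rewrite compm1 lunitK.
Qed.

(** By [rotation_cup] the rotation is a crossing followed by a twist, which is a scalar on a simple
    object. *)
Lemma FS_indicator2E X : is_simple X ->
  FS_indicator2 X = twist_scalar X * op_trace (@R_op R C 𝟙 X).
Proof.
move=> sX; rewrite /FS_indicator2 /op_trace mulr_sumr; apply: eq_bigr => i _.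
rewrite rotation_cup (twistE sX) tensZr tensm_id !compZl comp1m linearZ.
by [].
Qed.

End Final.

Theorem theorem3p2 (R : realType) (C : premodularCategory R)
    (m : nat) (X : 'I_m.+1 -> C)
    (X_simples : represents_simples X) (X0 : X ord0 = 𝟙)
    (a : 'I_m.+1) (a_self_dual : self_dual (X a)) :
  let N b c := (fusion_coef (X b) (X c) (X a))%:R : R[i] in
  let d b := qdim (X b) in
  let theta b := twist_scalar (X b) in
  let D2 := \sum_(b < m.+1) d b ^+ 2 in
  let TrR g := op_trace (@R_op R C (X g) (X a)) in
  FS_indicator2 (X a) =
    D2^-1 * (\sum_(b < m.+1) \sum_(c < m.+1)
               N b c * d b * d c * (theta b / theta c) ^+ 2)
    - theta a * (\sum_(g < m.+1 | (g != ord0) && `[< is_transparent (X g) >])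
                   d g * TrR g).
Proof.
move=> N d theta D2 TrR.
have D0 : D2 != 0 := global_dim_neq0 X_simples a.
rewrite (fusion_sum X_simples) -/D2 mulrCA [_ * D2]mulrC mulKf// -big_mkcond /=.
have t0 : `[< is_transparent (X ord0) >].
  by rewrite X0; apply/asboolP; exact: unit_transparent.
(* The unit is transparent of dimension 1: its term is the indicator, and the other terms cancel
   against the subtracted sum. *)
rewrite (bigD1 ord0)//= X0 qdim_unit mul1r (eq_bigl _ _ (fun g => andbC _ _)).
rewrite mulrDr addrK; apply: FS_indicator2E; exact: simpleS.
Qed.
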